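(* Let $p,q,e\in\mathbb Z$ with $0<p<q$, $\gcd(p,q)=1$, let $L=L(1/2,1/2,p/q;e)$ and $w=(e-1)q-p$. For $i=1,2,3$ let $\mathcal C_i$ be the connected component, containing the generator $i$, of the Cayley graph of $Q_2(L)$ with respect to the generators $1,2,3$. Then these components are, as edge-labeled graphs with the vertex representing the generator $i$ marked: (a) If $q$ is odd, then $\mathcal C_1=\mathcal C_3=\mathcal T_1/\langle\rho_{(0,0)},\rho_{(w,0)},\rho_{(0,2q)}\rangle$ and $\mathcal C_2=\mathcal T_2/\langle\tau_{(0,4)},\phi_{1/2},\phi_{w+1/2}\rangle$. (b) If $q$ is even, then $\mathcal C_1=\mathcal T_1/\langle\rho_{(0,0)},\rho_{(0,2q)},\gamma_{(2q,w/2)}\rangle$, $\mathcal C_2=\mathcal T_2/\langle\tau_{(0,4)},\phi_{1/2},\phi_{w+1/2}\rangle$, and $\mathcal C_3=\mathcal T_3/\langle\rho_{(0,2)},\rho_{(0,2+2q)},\gamma_{(2q,w/2)}\rangle$. The component $\mathcal C_3$ is obtained by trading all labels of $1$ and $3$ in $\mathcal C_1$.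
   Context: **Involutory quandles.** An involutory quandle is a set $Q$ with a binary operation $\rhd$ such that for all $x,y,z$: $x\rhd x=x$; $(x\rhd y)\rhd y=x$; $(x\rhd y)\rhd z=(x\rhd z)\rhd(y\rhd z)$. Write $x^y=x\rhd y$ and, for a word $y_1y_2\cdots y_k$, $x^{y_1y_2\cdots y_k}=(\cdots((x^{y_1})^{y_2})\cdots)^{y_k}$. For an unoriented link $L$, $Q_2(L)$ is the involutory quandle presented from any diagram with one generator per arc and, at each crossing with overcrossing arc $x_j$ and undercrossing arcs $x_i,x_k$, the relation $x_k^{x_j}=x_i$. **The links.** $L(1/2,1/2,p/q;e)$ is the numerator closure of the horizontal sum of the rational tangles $1/2$, $1/2$, $p/q$ and a row of $e$ right-handed horizontal half-twists (left-handed if $e<0$). Rational tangles are indexed so that $0$ is two horizontal arcs, rotation by $\pi/2$ sends $r$ to $-1/r$, and adding one left-handed horizontal half-twist on the right adds $1$; thus the link is the numerator closure of $1/2+1/2+p/q+(-e)$. **The generators $1,2,3$.** For a word $X$, $\overline X$ is $X$ written backwards; $[X]^n$ is $X$ repeated $n$ times if $n>0$, the empty word if $n=0$, and $[\overline X]^{-n}$ if $n<0$. Put $A=[21]^{e-2}2$, $B=[21]^{e-1}2$. The generators $1,2,3$ (three particular arcs of the standard diagram) are those of the presentation $Q_2(L)=\langle 1,2,3\mid R_1,R_2,R_3\rangle$, where $R_1$ is $2^1=2^3$ and: - $p,q$ odd: $R_2$: $3=1^{A[232B1B]^{(q-p)/2}[232A1A]^{(p-1)/2}2}$; $R_3$: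 $3=1^{B[232B1B]^{(q-p-2)/2}[232A1A]^{(p+1)/2}}$. - $p$ even, $q$ odd: $R_2$: $3=1^{B[232B1B]^{(q-p-1)/2}[232A1A]^{p/2}2}$; $R_3$: $3=1^{A[232B1B]^{(q-p-1)/2}[232A1A]^{p/2}}$. - $p$ odd, $q$ even: $R_2$: $3=3^{2[232B1B]^{(q-p-1)/2}[232A1A]^{(p+1)/2}}$; $R_3$: $1=1^{A[232B1B]^{(q-p+1)/2}[232A1A]^{(p-1)/2}B}$. **Cayley graph.** Its vertices are the elements of $Q_2(L)$; for each element $x$ and each generator $g\in\{1,2,3\}$ there is an undirected edge labeled $g$ joining $x$ and $x^g$ (a loop if $x^g=x$). **The graph $\mathcal T$.** Consider the rectangle with vertices $(0,1),(0,3),(0,5),(1,5),(1,3),(1,1)$, viewed as a graph with these six vertices and six edges (a hexagon). $\mathcal T$ is the union of all its translates by $(m,n)$ with $m,n\in\mathbb Z$, $n\equiv 2m\pmod 4$. All horizontal edges are labeled $2$; a vertical edge with upper endpoint $(x,y)$ is labeled $3$ if $y\equiv3\pmod4$ and $1$ if $y\equiv1\pmod 4$. $\mathcal T_i$ is $\mathcal T$ with the vertex $(0,1)$ labeled by the generator $i$. **Symmetries.** For integers $n,m$ the following are label-preserving automorphisms of $\mathcal T$: $\rho_{(n,2m)}$, rotation by $\pi$ about $(n,2m)$; $\tau_{(2n,4m)}$, translation $(x,y)\mapsto(x+2n,y+4m)$; $\phi_{n+1/2}$, reflection across the line $x=n+1/2$; $\gamma_{(4n,m+1/2)}=\tau_{(0,4n)}\circ\phi_{m+1/2}$.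 (When $q$ is even, $w$ is odd, so $\gamma_{(2q,w/2)}$ makes sense.) $\langle\psi_1,\dots,\psi_k\rangle$ denotes the generated group of automorphisms and $\mathcal T_i/\langle\psi_1,\dots,\psi_k\rangle$ the quotient labeled graph, whose vertices and edges are orbits of vertices and edges (an edge whose endpoints are identified becomes a loop); the image of $(0,1)$ represents the generator $i$. *)

(* Defs.v *)
From mathcomp Require Import all_boot all_order all_algebra.
From mathcomp Require Import boolp classical_sets functions.

Set Implicit Arguments.
Unset Strict Implicit.
Unset Printing Implicit Defensive.

Import Order.TTheory GRing.Theory Num.Theory.
Local Open Scope classical_set_scope.
Local Open Scope ring_scope.

Record invQuandle := InvQuandle {
  quandle_sort :> Type;
  qop : quandle_sort -> quandle_sort -> quandle_sort;
  qop_idem : forall x, qop x x = x;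
  qop_invol : forall x y, qop (qop x y) y = x;
  qop_dist : forall x y z, qop (qop x y) z = qop (qop x z) (qop y z) }.

Inductive term (X : Type) : Type :=
| Gen of X
| Op of term X & term X.

Fixpoint eval (X : Type) (Q : invQuandle) (g : X -> Q) (t : term X) : Q :=
  match t with
  | Gen x => g x
  | Op s t => qop (eval g s) (eval g t)
  end.

(** Equality of terms in the involutory quandle < X | R >: the least congruence
    that contains [R] and the quandle axioms. *)
Inductive qeq (X : Type) (R : term X -> term X -> Prop) :
    term X -> term X -> Prop :=
| qeq_rel s t : R s t -> qeq R s t
| qeq_refl s : qeq R s s
| qeq_sym s t : qeq R s t -> qeq R t s
| qeq_trans s t u : qeq R s t -> qeq R t u -> qeq R s u
| qeq_op s s' t t' : qeq R s s' -> qeq R t t' -> qeq R (Op s t) (Op s' t')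
| qeq_idem s : qeq R (Op s s) s
| qeq_invol s t : qeq R (Op (Op s t) t) s
| qeq_dist s t u : qeq R (Op (Op s t) u) (Op (Op s u) (Op t u)).

(** [Q] = < X | R >, where [g] gives the elements of [Q] named by [X]; i.e. [g]
    induces an isomorphism from the quotient of [term X] by [qeq R] to [Q]. *)
Definition presented (X : Type) (R : term X -> term X -> Prop)
    (Q : invQuandle) (g : X -> Q) : Prop :=
  (forall z : Q, exists t, eval g t = z) /\
  (forall s t, eval g s = eval g t <-> qeq R s t).

(** A diagram is recorded by its segments; [(a, b) \in joins D] says that [a]
    and [b] are consecutive segments of the same arc, and
    [(i, j, k) \in crossings D] that there is a crossing with overcrossing arc
    [j] and undercrossing arcs [i] and [k]. *)
Record diagram := Diagram {
  seg : eqType;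
  joins : seq (seg * seg);
  crossings : seq (seg * seg * seg) }.

(** The relations of Q_2: the segments of an arc name the same generator, and
    each crossing gives x_k ^ x_j = x_i. *)
Inductive Q2_rel (D : diagram) : term (seg D) -> term (seg D) -> Prop :=
| Q2_join a b : (a, b) \in joins D -> Q2_rel (Gen a) (Gen b)
| Q2_crossing i j k : (i, j, k) \in crossings D ->
    Q2_rel (Op (Gen k) (Gen j)) (Gen i).

Definition is_Q2 (D : diagram) (Q : invQuandle) (x : seg D -> Q) : Prop :=
  presented (@Q2_rel D) x.

Record tangle := Tangle {
  tdiag :> diagram;
  nw : seg tdiag;
  ne : seg tdiag;
  sw : seg tdiag;
  se : seg tdiag }.

(** Two horizontal arcs, [true] being the upper one. *)
Definition tzero : tangle :=
  @Tangle (@Diagram bool [::] [::]) true true false false.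

(** Counterclockwise rotation by pi/2. *)
Definition trot (t : tangle) : tangle :=
  @Tangle t (ne t) (se t) (nw t) (sw t).

(** One horizontal half-twist on the right.  The crossing is left-handed when
    the overcrossing strand runs from lower left to upper right, right-handed
    when it runs from upper left to lower right.  The undercrossing strand
    starts a new arc, [None]. *)
Definition ttwist (left_handed : bool) (t : tangle) : tangle :=
  let under := if left_handed then ne t else se t in
  let over := if left_handed then se t else ne t in
  @Tangle
    (@Diagram (option (seg t))
       [seq (Some d.1, Some d.2) | d <- joins t]
       ((Some under, Some over, None) ::
        [seq (Some c.1.1, Some c.1.2, Some c.2) | c <- crossings t]))
    (Some (nw t)) (if left_handed then Some over else None)
    (Some (sw t)) (if left_handed then None else Some over).

Definition thsum (t1 t2 : tangle) : tangle :=
  @Tangle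
    (@Diagram (seg t1 + seg t2)%type
       ([:: (inl (ne t1), inr (nw t2)); (inl (se t1), inr (sw t2))] ++
        [seq (inl d.1, inl d.2) | d <- joins t1] ++
        [seq (inr d.1, inr d.2) | d <- joins t2])
       ([seq (inl c.1.1, inl c.1.2, inl c.2) | c <- crossings t1] ++
        [seq (inr c.1.1, inr c.1.2, inr c.2) | c <- crossings t2]))
    (inl (nw t1)) (inr (ne t2)) (inl (sw t1)) (inr (se t2)).

Definition numerator_closure (t : tangle) : diagram :=
  @Diagram (seg t) ((nw t, ne t) :: (sw t, se t) :: joins t) (crossings t).

Inductive rdiag :=
| RZero
| RRot of rdiag
| RTwist of bool & rdiag.

Fixpoint rtangle (r : rdiag) : tangle :=
  match r with
  | RZero => tzero
  | RRot r => trot (rtangle r)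
  | RTwist b r => ttwist b (rtangle r)
  end.

(** The slope of a rational tangle as a pair (numerator, denominator), so that
    1/0 is allowed; the two integers are always coprime, but the denominator
    may be negative. *)
Fixpoint slope (r : rdiag) : int * int :=
  match r with
  | RZero => (0, 1)
  | RRot r => (- (slope r).2, (slope r).1)
  | RTwist b r =>
      ((slope r).1 + (if b then (slope r).2 else - (slope r).2), (slope r).2)
  end.

(** [r] is a diagram of the rational tangle a / b, for b <> 0. *)
Definition rational_diagram (r : rdiag) (a b : int) : Prop :=
  (slope r).1 * b = a * (slope r).2.

(** [e] right-handed half-twists, left-handed if [e < 0]. *)
Definition twist_row (e : int) : rdiag :=
  iter `|e|%N (RTwist (e < 0)) RZero.

(** [D] is a diagram of L(1/2, 1/2, p/q; e). *)
Definition montesinos_diagram (p q e : int) (D : diagram) : Prop :=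
  exists r1 r2 r3 : rdiag,
    [/\ rational_diagram r1 1 2, rational_diagram r2 1 2,
        rational_diagram r3 p q &
        D = numerator_closure
              (thsum (thsum (thsum (rtangle r1) (rtangle r2)) (rtangle r3))
                     (rtangle (twist_row e)))].

Inductive gen := g1 | g2 | g3.

Definition word := seq gen.

Definition wpow (X : word) (n : int) : word :=
  match n with
  | Posz k => flatten (nseq k X)
  | Negz k => flatten (nseq k.+1 (rev X))
  end.

Definition texp (x : gen) (W : word) : term gen :=
  foldl (fun t y => Op t (Gen y)) (Gen x) W.

Definition wA (e : int) : word := wpow [:: g2; g1] (e - 2) ++ [:: g2].
Definition wB (e : int) : word := wpow [:: g2; g1] (e - 1) ++ [:: g2].

(** [232B1B]^m [232A1A]^n *)
Definition wBA (e m n : int) : word :=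
  wpow ([:: g2; g3; g2] ++ wB e ++ [:: g1] ++ wB e) m ++
  wpow ([:: g2; g3; g2] ++ wA e ++ [:: g1] ++ wA e) n.

Definition evenz (n : int) : bool := (2 %| n)%Z.
Definition halfz (n : int) : int := (n %/ 2)%Z.

Inductive rel123 (p q e : int) : term gen -> term gen -> Prop :=
| rel_R1 : rel123 p q e (texp g2 [:: g1]) (texp g2 [:: g3])
| rel_R2_odd_odd : ~~ evenz p -> ~~ evenz q ->
    rel123 p q e (Gen g3)
      (texp g1 (wA e ++ wBA e (halfz (q - p)) (halfz (p - 1)) ++ [:: g2]))
| rel_R3_odd_odd : ~~ evenz p -> ~~ evenz q ->
    rel123 p q e (Gen g3)
      (texp g1 (wB e ++ wBA e (halfz (q - p - 2)) (halfz (p + 1))))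
| rel_R2_even_odd : evenz p -> ~~ evenz q ->
    rel123 p q e (Gen g3)
      (texp g1 (wB e ++ wBA e (halfz (q - p - 1)) (halfz p) ++ [:: g2]))
| rel_R3_even_odd : evenz p -> ~~ evenz q ->
    rel123 p q e (Gen g3)
      (texp g1 (wA e ++ wBA e (halfz (q - p - 1)) (halfz p)))
| rel_R2_odd_even : ~~ evenz p -> evenz q ->
    rel123 p q e (Gen g3)
      (texp g3 (g2 :: wBA e (halfz (q - p - 1)) (halfz (p + 1))))
| rel_R3_odd_even : ~~ evenz p -> evenz q ->
    rel123 p q e (Gen g1)
      (texp g1 (wA e ++ wBA e (halfz (q - p + 1)) (halfz (p - 1)) ++ wB e)).

(** Undirected, with vertices in [V] and edges in [E]; [inc G a v] says that
    [v] is an endpoint of [a], so a loop is an edge with only one endpoint. *)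
Record lgraph (V E : Type) := LGraph {
  verts : set V;
  edges : set E;
  lab : E -> gen -> Prop;
  inc : E -> V -> Prop }.

(** [G] with [x] marked and [H] with [y] marked are isomorphic. *)
Definition marked_iso (V E V' E' : Type) (G : lgraph V E) (x : V)
    (H : lgraph V' E') (y : V') : Prop :=
  exists (f : V -> V') (h : E -> E'),
    [/\ set_bij (verts G) (verts H) f,
        set_bij (edges G) (edges H) h,
        f x = y,
        forall a l, edges G a -> (lab G a l <-> lab H (h a) l) &
        forall a v, edges G a -> verts G v ->
          (inc G a v <-> inc H (h a) (f v))].

Inductive connected_to (V E : Type) (G : lgraph V E) (x : V) : V -> Prop :=
| conn_refl : connected_to G x x
| conn_step a u v : connected_to G x u -> edges G a -> inc G a u ->
    inc G a v -> connected_to G x v.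

Definition component (V E : Type) (G : lgraph V E) (x : V) : lgraph V E :=
  LGraph [set v | verts G v /\ connected_to G x v]
         [set a | edges G a /\ exists2 v, inc G a v & connected_to G x v]
         (lab G) (inc G).

Definition swap13 (l : gen) : gen :=
  match l with g1 => g3 | g2 => g2 | g3 => g1 end.

Definition trade13 (V E : Type) (G : lgraph V E) : lgraph V E :=
  LGraph (verts G) (edges G) (fun a l => lab G a (swap13 l)) (inc G).

(** The edge labeled [l] that joins x and x ^ l is the pair of [l] and the set
    {x, x ^ l}. *)
Definition cayley (Q : invQuandle) (g : gen -> Q) : lgraph Q (gen * set Q) :=
  LGraph setT
         [set a | exists x l, a = (l, [set x; qop x (g l)])]
         (fun a l => a.1 = l)
         (fun a v => a.2 v).

Inductive generated (V : Type) (S : set (V -> V)) : (V -> V) -> Prop :=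
| gen_in f : S f -> generated S f
| gen_id : generated S id
| gen_comp f h : generated S f -> generated S h -> generated S (f \o h)
| gen_inv f h : generated S f -> cancel f h -> cancel h f -> generated S h.

Definition vert_orbit (V : Type) (S : set (V -> V)) (v : V) : set V :=
  [set f v | f in generated S].

Definition edge_orbit (V : Type) (S : set (V -> V)) (a : set V) : set (set V) :=
  [set f @` a | f in generated S].

(** The quotient of [G] by the group generated by [S], where the edges of [G]
    are given as their sets of endpoints. *)
Definition quotient (V : Type) (G : lgraph V (set V)) (S : set (V -> V)) :
    lgraph (set V) (set (set V)) :=
  LGraph (vert_orbit S @` verts G)
         (edge_orbit S @` edges G)
         (fun o l => exists2 a, o a & lab G a l)
         (fun o w => exists a v, [/\ o a, inc G a v & w = vert_orbit S v]).

Notation point := (int * int)%type.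

Definition tau (a b : int) (v : point) : point := (v.1 + a, v.2 + b).

(** [rho n k] is the rotation by pi about (n, k), [phi n] the reflection across
    the line x = n + 1/2, and [gamma n m] is gamma_(4n, m + 1/2). *)
Definition rho (n k : int) (v : point) : point := (2 * n - v.1, 2 * k - v.2).
Definition phi (n : int) (v : point) : point := (2 * n + 1 - v.1, v.2).
Definition gamma (n m : int) (v : point) : point := tau 0 (4 * n) (phi m v).

Definition hexagon : seq point :=
  [:: (0, 1); (0, 3); (0, 5); (1, 5); (1, 3); (1, 1)].

Definition hex_vertex (k : nat) : point := nth (0, 1) hexagon (k %% 6)%N.

Definition Tgraph : lgraph point (set point) :=
  LGraph
    [set v | exists m n k,
       (n = 2 * m %[mod 4])%Z /\ v = tau m n (hex_vertex k)]
    [set a | exists m n k, (n = 2 * m %[mod 4])%Z /\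
       a = [set tau m n (hex_vertex k); tau m n (hex_vertex k.+1)]]
    (fun a l => exists x y : int,
       match l with
       | g1 => (y = 1 %[mod 4])%Z /\ a = [set (x, y - 2); (x, y)]
       | g2 => a = [set (x, y); (x + 1, y)]
       | g3 => (y = 3 %[mod 4])%Z /\ a = [set (x, y - 2); (x, y)]
       end)
    (fun a v => a v).

(** [C] with [x] marked is T_i / < S >, where i is the generator represented
    by [x]. *)
Definition is_T_quotient (V E : Type) (C : lgraph V E) (x : V)
    (S : set (point -> point)) : Prop :=
  marked_iso C x (quotient Tgraph S) (vert_orbit S (0, 1)).

(* Main.v *)
Require Import Defs.
From mathcomp Require Import all_boot all_order all_algebra.
From mathcomp Require Import zify ring.
From mathcomp Require Import boolp classical_sets functions.

Set Implicit Arguments.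
Unset Strict Implicit.
Unset Printing Implicit Defensive.

Import Order.TTheory GRing.Theory Num.Theory.
Local Open Scope classical_set_scope.
Local Open Scope ring_scope.

(** The quandle < 1, 2, 3 | R_1 > is explicit: its elements are the points
    (X, Z) of Z x Z (the classes of 1 and 3, for Z odd and Z even) and the
    integers k (the class of 2), where (X, Z) acts by the point reflection
    through (X, Z) and k by the reflection across the line X = k - 1/2.  In
    these coordinates the relators R_2 and R_3 say precisely that points are
    taken modulo the lattice spanned by (w, q) and (w, - q), and the integers k
    modulo 2 w.  A vertex (x, y) of T corresponds to the point obtained from
    (x, y) by changing the signs of the coordinates according to the directions
    in which the edges labeled 1, 2 and 3 leave (x, y); two vertices have the
    same image exactly when they are in the same orbit of the stated group.

    For the diagram: the involutory quandle of a rational tangle a / b is the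
    dihedral quandle Z, its ends NW, NE, SW and SE being 0, a, b and a + b.
    Gluing p / q to the row of twists gives a map f from Z to Q_2(L) with
    f(q X - w Z) = (X, Z), which exists exactly when the lattice above acts
    trivially. *)

(** * Involutory quandles and presentations *)

Definition qhom (Q Q' : invQuandle) (f : Q -> Q') : Prop :=
  forall x y, f (qop x y) = qop (f x) (f y).

Lemma eval_qhom (X : Type) (Q Q' : invQuandle) (f : Q -> Q') (g : X -> Q) t :
  qhom f -> f (eval g t) = eval (f \o g) t.
Proof. by move=> hf; elim: t => //= s <- t <-; rewrite hf. Qed.

Definition act (Q : invQuandle) (g : gen -> Q) : Q -> word -> Q :=
  foldl (fun u y => qop u (g y)).

Lemma act_cat (Q : invQuandle) (g : gen -> Q) u W W' :
  act g u (W ++ W') = act g (act g u W) W'.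
Proof. exact: foldl_cat. Qed.

Lemma eval_texp (Q : invQuandle) (g : gen -> Q) l W :
  eval g (texp l W) = act g (g l) W.
Proof.
rewrite /texp /act -[g l]/(eval g (Gen l)).
by elim: W (Gen l) => //= y W IH t; rewrite IH.
Qed.

Lemma qeq_eval (X : Type) (R : term X -> term X -> Prop) (Q : invQuandle)
    (g : X -> Q) :
  (forall s t, R s t -> eval g s = eval g t) ->
  forall s t, qeq R s t -> eval g s = eval g t.
Proof.
move=> gR s t; elim=> /=.
- exact: gR.
- by [].
- by [].
- by move=> ? ? ? _ -> _ ->.
- by move=> ? ? ? ? _ -> _ ->.
- by move=> ?; rewrite qop_idem.
- by move=> ? ?; rewrite qop_invol.
- by move=> ? ? ?; rewrite qop_dist.
Qed.

Lemma presented_rel (X : Type) (R : term X -> term X -> Prop) (Q : invQuandle)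
    (g : X -> Q) s t :
  presented R g -> R s t -> eval g s = eval g t.
Proof. by move=> [_ gR] Rst; apply/gR/qeq_rel. Qed.

Lemma presented_lift (X : Type) (R : term X -> term X -> Prop)
    (Q Q' : invQuandle) (g : X -> Q) (g' : X -> Q') s t :
  presented R g -> (forall s t, R s t -> eval g' s = eval g' t) ->
  eval g s = eval g t -> eval g' s = eval g' t.
Proof. by move=> [_ gR] g'R /gR; apply: qeq_eval. Qed.

(** Elements are the classes [E x] as sets, and the operation works on chosen representatives;
    extensionality turns related representatives into equal classes. *)
Lemma quotient_quandle (T : Type) (op : T -> T -> T) (E : T -> T -> Prop) :
  (forall x, E x x) -> (forall x y, E x y -> E y x) ->
  (forall x y z, E x y -> E y z -> E x z) ->
  (forall x x' y y', E x x' -> E y y' -> E (op x y) (op x' y')) ->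
  (forall x, E (op x x) x) -> (forall x y, E (op (op x y) y) x) ->
  (forall x y z, E (op (op x y) z) (op (op x z) (op y z))) ->
  exists (Q : invQuandle) (c : T -> Q),
    [/\ forall z, exists x, c x = z,
        forall x y, c x = c y <-> E x y &
        forall x y, c (op x y) = qop (c x) (c y)].
Proof.
move=> Er Es Et Eop Ei Ev Ed.
pose C := {c : set T | exists x, c = E x}.
pose cls x : C :=
  exist (fun c : set T => exists x, c = E x) (E x) (ex_intro _ x erefl).
pose rep (c : C) : T := projT1 (cid (svalP c)).
have clsE x y : cls x = cls y <-> E x y.
  split=> [[exy]|exy]; first by rewrite exy.
  apply: eq_exist; apply/funext => z; apply/propext; split; apply: Et => //.
  exact: Es.
have repK c : cls (rep c) = c.
  rewrite /rep; case: cid => y; case: c => c hc /= ey.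
  by rewrite /cls; apply: eq_exist.
have Erep x : E (rep (cls x)) x by apply/clsE; rewrite repK.
pose mul c d := cls (op (rep c) (rep d)).
have mulE x y : mul (cls x) (cls y) = cls (op x y).
  by apply/clsE; apply: Eop; apply: Erep.
have m1 c : mul c c = c by rewrite -[c]repK mulE; apply/clsE.
have m2 c d : mul (mul c d) d = c.
  by rewrite -[c]repK -[d]repK !mulE; apply/clsE.
have m3 c d e : mul (mul c d) e = mul (mul c e) (mul d e).
  by rewrite -[c]repK -[d]repK -[e]repK !mulE; apply/clsE.
exists (InvQuandle m1 m2 m3), cls; split=> //.
by move=> z; exists (rep z).
Qed.

Lemma presented_exists (X : Type) (R : term X -> term X -> Prop) :
  exists (Q : invQuandle) (g : X -> Q), presented R g.
Proof.
have [|||||||Q [c [csurj cE cop]]] :=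
  @quotient_quandle (term X) (@Op X) (qeq R).
- exact: qeq_refl.
- by move=> ? ?; apply: qeq_sym.
- by move=> ? ? ?; apply: qeq_trans.
- by move=> ? ? ? ?; apply: qeq_op.
- exact: qeq_idem.
- exact: qeq_invol.
- exact: qeq_dist.
exists Q, (fun i => c (Gen i)).
have evE t : eval (fun i => c (Gen i)) t = c t.
  by elim: t => //= s -> t ->; rewrite cop.
split=> [z|s t]; last by rewrite !evE.
by have [t <-] := csurj z; exists t.
Qed.

(** * The dihedral quandle of the integers and its homomorphisms *)

Lemma dihedral_idem (x : int) : 2 * x - x = x.
Proof. by lia. Qed.

Lemma dihedral_invol (x y : int) : 2 * y - (2 * y - x) = x.
Proof. by lia. Qed.

Lemma dihedral_dist (x y z : int) :
  2 * z - (2 * y - x) = 2 * (2 * z - y) - (2 * z - x).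
Proof. by lia. Qed.

(** The core quandle of Z, in which [y] acts as the point reflection through [y]. It is the free
    involutory quandle on 0 and 1, by [line_exists] and [line_eq]. *)
Definition dihedral : invQuandle :=
  @InvQuandle int (fun x y => 2 * y - x)
    dihedral_idem dihedral_invol dihedral_dist.

Lemma qop_inj (Q : invQuandle) (x y z : Q) : qop x z = qop y z -> x = y.
Proof. by move=> /(congr1 (fun u => qop u z)); rewrite !qop_invol. Qed.

Definition line (Q : invQuandle) (h : int -> Q) : Prop :=
  qhom (h : dihedral -> Q).

Lemma lineE (Q : invQuandle) (h : int -> Q) n m k :
  line h -> k = 2 * m - n -> qop (h n) (h m) = h k.
Proof. by move=> hh ->; rewrite -hh. Qed.

(** Acting by a fixed element is invertible, so the recursion runs in both directions and two
    consecutive values determine the sequence. *)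
Lemma line_step_eq (Q : invQuandle) (h h' : int -> Q) k :
  (forall n, qop (h (n - 1)) (h n) = h (n + 1)) ->
  (forall n, qop (h' (n - 1)) (h' n) = h' (n + 1)) ->
  h k = h' k -> h (k + 1) = h' (k + 1) -> h =1 h'.
Proof.
move=> sh sh' e0 e1 n.
suff /(_ (n - k)) [] : forall m, h (k + m) = h' (k + m) /\
    h (k + m + 1) = h' (k + m + 1) by rewrite addrC subrK.
elim/int_rec=> [|m [IH0 IH1]|m [IH0 IH1]].
- by rewrite addr0.
- have -> : k + m.+1%:Z = k + m%:Z + 1 by lia.
  by split=> //; rewrite -sh -sh' IH1 addrK IH0.
- have -> : k - m.+1%:Z = k - m%:Z - 1 by lia.
  split; last by rewrite subrK.
  by apply: (@qop_inj _ _ _ (h (k - m%:Z))); rewrite sh IH0 sh'.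
Qed.

Lemma line_step (Q : invQuandle) (h : int -> Q) n :
  line h -> qop (h (n - 1)) (h n) = h (n + 1).
Proof. by move=> hh; apply: lineE => //; lia. Qed.

Lemma line_eq (Q : invQuandle) (h h' : int -> Q) k :
  line h -> line h' -> h k = h' k -> h (k + 1) = h' (k + 1) -> h =1 h'.
Proof. by move=> hh hh'; apply: line_step_eq => n; apply: line_step. Qed.

(** Acting by [h m] is an automorphism, so both sides of the identity, as sequences in the first
    index, satisfy the same recursion; they agree at m and m + 1. *)
Lemma stepsP (Q : invQuandle) (h : int -> Q) :
  (forall n, qop (h (n - 1)) (h n) = h (n + 1)) -> line h.
Proof.
move=> sh n m.
have sh1 k : qop (h (k + 1)) (h k) = h (k - 1) by rewrite -sh qop_invol.
have := @line_step_eq _ (fun k => h (2 * m - k)) (fun k => qop (h k) (h m)) m.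
apply=> [k|k||].
- by rewrite opprD opprK addrA sh1; congr h; lia.
- by rewrite -qop_dist sh.
- by rewrite qop_idem; congr h; lia.
- by rewrite sh1; congr h; lia.
Qed.

Lemma line_exists (Q : invQuandle) (u v : Q) :
  exists h : int -> Q, [/\ line h, h 0 = u & h 1 = v].
Proof.
pose st (x : Q * Q) := (x.2, qop x.1 x.2).
pose s u v n := (iter n st (u, v)).1.
have sS a b n : s a b n.+1 = (iter n st (a, b)).2 by rewrite /s iterS.
have sSS a b n : s a b n.+2 = qop (s a b n) (s a b n.+1).
  by rewrite sS [in RHS]sS /s iterS.
(* Negative indices run the recursion from the reversed pair (v, u), where v and u have indices 0
   and 1, so that -1 gets index 2. *)
pose h (n : int) := match n with Posz k => s u v k | Negz k => s v u k.+2 end.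
exists h; split=> //; apply: stepsP => -[[|n]|[|[|n]]].
- by rewrite /h /s /= qop_invol.
- have -> : n.+1%:Z - 1 = n by lia.
  have -> : n.+1%:Z + 1 = n.+2 by lia.
  by rewrite /= sSS.
- by rewrite /h /s /= qop_dist qop_idem !qop_invol.
- have -> : Negz 1 - 1 = Negz 2 by lia.
  have -> : Negz 1 + 1 = Negz 0 by lia.
  by rewrite /h sSS qop_invol.
- have -> : Negz n.+2 - 1 = Negz n.+3 by lia.
  have -> : Negz n.+2 + 1 = Negz n.+1 by lia.
  by rewrite /h sSS qop_invol.
Qed.

Lemma line_affine (Q : invQuandle) (h : int -> Q) a b :
  line h -> line (fun n => h (a + n * b)).
Proof. by move=> hh n m /=; apply/esym/lineE => //=; ring. Qed.

Lemma line_qop (Q : invQuandle) (h : int -> Q) z :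
  line h -> line (fun n => qop (h n) z).
Proof. by move=> hh n m; rewrite hh qop_dist. Qed.

(** * The quandle of the relation R_1 *)

Lemma qop_conj (Q : invQuandle) (x y z : Q) :
  qop x (qop y z) = qop (qop (qop x z) y) z.
Proof. by rewrite [RHS]qop_dist qop_invol. Qed.

Definition R1_sort : Type := ((int * int) + int)%type.

(** The value is the mirror image of the point or vertical line [u] under the reflection [v], whence
    the axioms; the offsets by 1 come from the lines X = k - 1/2. *)
Definition R1_op (u v : R1_sort) : R1_sort :=
  match u, v with
  | inl a, inl b => inl (2 * b.1 - a.1, 2 * b.2 - a.2)
  | inl a, inr k => inl (2 * k - 1 - a.1, a.2)
  | inr k, inl b => inr (2 * b.1 + 1 - k)
  | inr k, inr l => inr (2 * l - k)
  end.

Local Ltac R1_lia := first [congr (inl (_, _)) | congr inr]; lia.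

Lemma R1_idem u : R1_op u u = u.
Proof. by case: u => [[x z]|k] /=; R1_lia. Qed.

Lemma R1_invol u v : R1_op (R1_op u v) v = u.
Proof. by case: u v => [[x z]|k] [[x' z']|k'] /=; R1_lia. Qed.

Lemma R1_dist u v t :
  R1_op (R1_op u v) t = R1_op (R1_op u t) (R1_op v t).
Proof.
by case: u v t => [[x z]|k] [[x' z']|k'] [[x'' z'']|k''] /=; R1_lia.
Qed.

Definition R1_quandle : invQuandle := InvQuandle R1_idem R1_invol R1_dist.

(** The centers of 1 and 3 both lie on X = 0, so their point reflections agree on vertical lines:
    this is R_1. *)
Definition base (l : gen) : R1_quandle :=
  match l with g1 => inl (0, 1) | g2 => inr 0 | g3 => inl (0, 0) end.

Lemma int_step_ind (P : int -> Prop) :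
  P 0 -> (forall n, P n -> P (n + 1)) -> (forall n, P n -> P (n - 1)) ->
  forall n, P n.
Proof.
move=> P0 PS PP; elim/int_rec => [|m IH|m IH] //.
- by rewrite (_ : m.+1%:Z = m%:Z + 1); [apply: PS|lia].
- by rewrite (_ : - m.+1%:Z = - m%:Z - 1); [apply: PP|lia].
Qed.

(* (X, Z) and k are moved by 1 as (- X, 2 - Z) and 1 - k, by 2 as (- 1 - X, Z)
   and - k, and by 3 as (- X, - Z) and 1 - k. *)
Lemma R1_ind (P : R1_quandle -> Prop) :
  (forall l, P (base l)) -> (forall l u, P u -> P (qop u (base l))) ->
  forall u, P u.
Proof.
move=> Pb PS.
have s1 x z : P (inl (x, z)) -> P (inl (- x, 2 - z)).
  by move=> /(PS g1) /=; congr (P (inl (_, _))); lia.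
have s2 x z : P (inl (x, z)) -> P (inl (- 1 - x, z)).
  by move=> /(PS g2) /=; congr (P (inl (_, _))); lia.
have s3 x z : P (inl (x, z)) -> P (inl (- x, - z)).
  by move=> /(PS g3) /=; congr (P (inl (_, _))); lia.
(* Acting by 3 and then by 1 raises Z by 2 on X = 0, hence the induction on the pair z, z + 1. *)
have sz z : P (inl (0, z)).
  suff [] : P (inl (0, z)) /\ P (inl (0, z + 1)) by [].
  elim/int_step_ind: z => [|n [P0 P1]|n [P0 P1]].
  - by split; [apply: (Pb g3)|apply: (Pb g1)].
  - split=> //; move: P0 => /s3 /s1; congr (P (inl (_, _))); lia.
  - rewrite subrK; split=> //; move: P1 => /s1 /s3.
    by congr (P (inl (_, _))); lia.
have sx x : forall z, P (inl (x, z)).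
  elim/int_step_ind: x => [//|n IH z|n IH z].
  - have /s2/s3 := IH (- z); congr (P (inl (_, _))); lia.
  - have /s3/s2 := IH (- z); congr (P (inl (_, _))); lia.
case=> [[x z] //|k]; elim/int_step_ind: k => [|n IH|n IH].
- exact: (Pb g2).
- by have /= := PS g1 _ (PS g2 _ IH); congr (P (inr _)); lia.
- by have /= := PS g2 _ (PS g1 _ IH); congr (P (inr _)); lia.
Qed.

(** Induction on the acting element: acting by v^l is acting by l, v and l in turn. *)
Lemma R1_qhom (Q : invQuandle) (F : R1_quandle -> Q) (g : gen -> Q) :
  (forall l, F (base l) = g l) ->
  (forall l u, F (qop u (base l)) = qop (F u) (g l)) -> qhom F.
Proof.
move=> Fb FS u v; elim/R1_ind: v u => [l|l v IH] u; first by rewrite Fb FS.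
rewrite FS -[u in LHS](@qop_invol _ _ (base l)) -qop_dist FS IH FS.
by rewrite qop_dist qop_invol.
Qed.

(* [R1_quandle] is < 1, 2, 3 | R_1 >. *)
Lemma R1_universal (Q : invQuandle) (g : gen -> Q) :
  qop (g g2) (g g1) = qop (g g2) (g g3) ->
  exists F : R1_quandle -> Q, qhom F /\ forall l, F (base l) = g l.
Proof.
move=> r1.
(* [d z] is to be the image of (0, z), and [e k] below that of the element k of the class of 2. *)
have [d [hd d0 d1]] := line_exists (g g3) (g g1).
have [e [he e0 e1]] := line_exists (g g2) (qop (g g2) (g g1)).
(* R_1 gives z = 0 and z = 1. Further terms of [d] act as conjugates of known ones, all of which
   exchange [g g2] and [e 1]. *)
have de z : qop (g g2) (d z) = e 1.
  have dS m n k : k = 2 * m - n ->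
      qop (g g2) (d n) = e 1 -> qop (g g2) (d m) = e 1 ->
      qop (g g2) (d k) = e 1.
    move=> /(lineE hd) <- en em.
    by rewrite qop_conj em -en qop_invol em.
  suff [] : qop (g g2) (d z) = e 1 /\ qop (g g2) (d (z + 1)) = e 1 by [].
  elim/int_step_ind: z => [|n [E0 E1]|n [E0 E1]].
  - by rewrite d0 add0r d1 e1.
  - by split=> //; apply: dS E0 E1; lia.
  - by rewrite subrK; split=> //; apply: dS E1 E0; lia.
have ed z : qop (e 1) (d z) = g g2 by rewrite -(de z) qop_invol.
(* [f z] is to be the row at height z: [e 1] is the reflection across X = 1/2 and carries (0, z) to
   (1, z). *)
have f_ex z : exists f : int -> Q,
    [/\ line f, f 0 = d z & f 1 = qop (d z) (e 1)] by apply: line_exists.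
have [f hf] := choice f_ex.
have fl z : line (f z) by have [] := hf z.
have f0 z : f z 0 = d z by have [] := hf z.
have f1 z : f z 1 = qop (d z) (e 1) by have [] := hf z.
have fN1 z : f z (- 1) = qop (d z) (g g2).
  rewrite -(@lineE _ _ 1 0 _ (fl z)) // f0 f1 qop_dist qop_idem.
  by rewrite ed.
(* 1 and 3 exchange [g g2] and [e 1] and permute the [d z], so they carry rows to rows with X
   reversed. *)
have ref z x l m (el : qop (e 1) (g l) = g g2) (dl : qop (d z) (g l) = d m) :
    qop (f z x) (g l) = f m (- x).
  have := @line_eq _ (fun x => qop (f z x) (g l)) (fun x => f m (- x)) 0.
  apply; first exact: line_qop.
  - by move=> i j; rewrite -fl /=; congr (f m _); rewrite /=; lia.
  - by rewrite f0 oppr0 f0.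
  - by rewrite add0r f1 qop_dist dl el fN1.
pose F (u : R1_quandle) : Q :=
  match u with inl a => f a.2 a.1 | inr k => e k end.
exists F; suff [Fb FS] : (forall l, F (base l) = g l) /\
    (forall l u, F (qop u (base l)) = qop (F u) (g l)).
  by split=> //; apply: R1_qhom FS.
split; first by case=> /=; rewrite ?f0 ?d0 ?d1 ?e0.
have eref k l : qop (g g2) (g l) = e 1 -> qop (e k) (g l) = e (1 - k).
  move=> el.
  have := @line_eq _ (fun x => qop (e x) (g l)) (fun x => e (1 - x)) 0.
  apply; first exact: line_qop.
  - by move=> i j; rewrite -he /=; congr e; rewrite /=; lia.
  - by rewrite e0 subr0.
  - by rewrite add0r subrr e0 -el qop_invol.
case=> [[[x z]|k]|[[x z]|k]|[[x z]|k]] /=.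
- rewrite (ref _ _ g1 (2 * 1 - z)) ?e1 ?qop_invol //; last first.
    by rewrite -d1; apply: lineE.
  by congr (f _ _); lia.
- by rewrite eref ?e1 //; congr e; lia.
(* The element 2 reflects each row by X -> -1 - X; the two lines are compared at -1 and 0. *)
- have := @line_eq _ (fun x => f z (- 1 - x)) (fun x => qop (f z x) (g g2))
    (- 1).
  move=> /(_ _ _ _ _ x) <-; first by congr (f z); lia.
  + by move=> i j; rewrite -fl /=; congr (f z); rewrite /=; lia.
  + exact: line_qop.
  + by rewrite subrr f0 fN1 qop_invol.
  + by rewrite addNr subr0 fN1 f0.
- by rewrite -[in RHS]e0; apply/esym/lineE.
- rewrite (ref _ _ g3 (2 * 0 - z)) ?e1 ?r1 ?qop_invol //; last first.
    by rewrite -d0; apply: lineE.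
  by congr (f _ _); lia.
- by rewrite eref ?e1 //; congr e; lia.
Qed.

(** * The congruence given by the lattice *)

Definition lattice_eq (w q : int) (u v : R1_quandle) : Prop :=
  match u, v with
  | inl a, inl b =>
      exists i j, b.1 = a.1 + w * (i + j) /\ b.2 = a.2 + q * (i - j)
  | inr k, inr l => exists i, l = k + 2 * w * i
  | _, _ => False
  end.

Lemma lattice_eq_refl w q u : lattice_eq w q u u.
Proof.
case: u => [a|k]; first by exists 0, 0; split; ring.
by exists 0; ring.
Qed.

Lemma lattice_eq_sym w q u v : lattice_eq w q u v -> lattice_eq w q v u.
Proof.
case: u v => [a|k] [b|l] //= => [[i [j [-> ->]]]|[i ->]].
  by exists (- i), (- j); split; ring.
by exists (- i); ring.
Qed.

Lemma lattice_eq_trans w q u v t :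
  lattice_eq w q u v -> lattice_eq w q v t -> lattice_eq w q u t.
Proof.
case: u v t => [a|k] [b|l] [c|m] //=.
  move=> [i [j [-> ->]]] [i' [j' [-> ->]]].
  by exists (i + i'), (j + j'); split; ring.
by move=> [i ->] [j ->]; exists (i + j); ring.
Qed.

(** Point reflections negate the lattice, while a reflection in a vertical line sends (w, q) to -
    (w, - q), so that [i] and [j] trade places. *)
Lemma lattice_eq_qop w q u u' v v' :
  lattice_eq w q u u' -> lattice_eq w q v v' ->
  lattice_eq w q (qop u v) (qop u' v').
Proof.
case: u u' v v' => [a|k] [a'|k'] [b|l] [b'|l'] //=.
- move=> [i [j [-> ->]]] [i' [j' [-> ->]]].
  by exists (2 * i' - i), (2 * j' - j); split; ring.
- move=> [i [j [-> ->]]] [i' ->].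
  by exists (2 * i' - j), (2 * i' - i); split; ring.
- move=> [i ->] [i' [j' [-> _]]].
  by exists (i' + j' - i); ring.
- by move=> [i ->] [j ->]; exists (2 * j - i); ring.
Qed.

Lemma lattice_quotient w q :
  exists (M : invQuandle) (c : R1_quandle -> M),
    [/\ qhom c, forall z, exists u, c u = z &
        forall u v, c u = c v <-> lattice_eq w q u v].
Proof.
have eqr u v : u = v -> lattice_eq w q u v.
  by move=> ->; apply: lattice_eq_refl.
have [|||||||M [c [cs cE ch]]] :=
    @quotient_quandle R1_quandle (@qop _) (lattice_eq w q).
- exact: lattice_eq_refl.
- exact: lattice_eq_sym.
- exact: lattice_eq_trans.
- by move=> *; apply: lattice_eq_qop.
- by move=> u; apply: eqr; apply: qop_idem.
- by move=> u v; apply: eqr; apply: qop_invol.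
- by move=> u v t; apply: eqr; apply: qop_dist.
by exists M, c.
Qed.

Lemma lattice_eq_invariant w q (T : Type) (F : R1_quandle -> T) :
  (forall x z, F (inl (x, z)) = F (inl (x + w, z + q))) ->
  (forall x z, F (inl (x, z)) = F (inl (x + w, z - q))) ->
  (forall k, F (inr k) = F (inr (k + 2 * w))) ->
  forall u v, lattice_eq w q u v -> F u = F v.
Proof.
move=> Fp Fm Fk.
have P x z i : F (inl (x, z)) = F (inl (x + w * i, z + q * i)).
  elim/int_step_ind: i => [|i ->|i ->]; first by rewrite !mulr0 !addr0.
    by rewrite Fp; congr (F (inl (_, _))); ring.
  by rewrite [RHS]Fp; congr (F (inl (_, _))); ring.
have M x z i : F (inl (x, z)) = F (inl (x + w * i, z - q * i)).
  elim/int_step_ind: i => [|i ->|i ->]; first by rewrite !mulr0 subr0 addr0.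
    by rewrite Fm; congr (F (inl (_, _))); ring.
  by rewrite [RHS]Fm; congr (F (inl (_, _))); ring.
case=> [[x z]|k] [[x' z']|k'] //= => [[i [j [-> ->]]]|[i ->]].
  rewrite (P x z i) (M (x + w * i) _ j); congr (F (inl (_, _))); ring.
elim/int_step_ind: i => [|i ->|i ->]; first by rewrite mulr0 addr0.
  by rewrite Fk; congr (F (inr _)); ring.
by rewrite [RHS]Fk; congr (F (inr _)); ring.
Qed.

(** * The relators R_2 and R_3 *)

Lemma act_nil (Q : invQuandle) (g : gen -> Q) u : act g u [::] = u.
Proof. by []. Qed.

Lemma act_cons (Q : invQuandle) (g : gen -> Q) u y W :
  act g u (y :: W) = act g (qop u (g y)) W.
Proof. by []. Qed.

Arguments act : simpl never.

Lemma act_1 (x z : int) : act base (inl (x, z)) [:: g1] = inl (- x, 2 - z).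
Proof. by rewrite act_cons act_nil /=; congr (inl (_, _)); lia. Qed.

Lemma act_2 (x z : int) : act base (inl (x, z)) [:: g2] = inl (- 1 - x, z).
Proof. by rewrite act_cons act_nil /=; congr (inl (_, _)); lia. Qed.

Lemma act_232 (x z : int) :
  act base (inl (x, z)) [:: g2; g3; g2] = inl (- 2 - x, - z).
Proof. by rewrite !act_cons act_nil /=; congr (inl (_, _)); lia. Qed.

Lemma act_flatten_nseq (x z a b : int) (W : word) (n : nat) :
  (forall x z, act base (inl (x, z)) W = inl (x + a, z + b)) ->
  act base (inl (x, z)) (flatten (nseq n W)) = inl (x + n%:Z * a, z + n%:Z * b).
Proof.
move=> hW; elim: n x z => [|n IH] x z /=; first by rewrite !mul0r !addr0.
by rewrite act_cat hW IH; congr (inl (_, _)); lia.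
Qed.

(** The word 21 shifts X by 1 and reflects Z in 1, so only the parity of the exponent affects Z. *)
Lemma act_wpow21 (x z n : int) :
  act base (inl (x, z)) (wpow [:: g2; g1] n) =
  inl (x + n, if evenz n then z else 2 - z).
Proof.
rewrite /evenz; case: n => n.
  elim: n x z => [|n IH] x z; first by rewrite /= addr0.
  rewrite !act_cons IH /=.
  by congr (inl (_, _)); last (do 2 case: ifP); lia.
have E x' z' : act base (inl (x', z')) [:: g1; g2] = inl (x' - 1, 2 - z').
  by rewrite !act_cons act_nil /=; congr (inl (_, _)); lia.
rewrite (_ : wpow _ _ = flatten (nseq n.+1 [:: g1; g2])) //.
elim: n x z => [|n IH] x z; first by rewrite E; congr (inl (_, _)); lia.
rewrite -[flatten _]/([:: g1; g2] ++ flatten (nseq n.+1 [:: g1; g2])).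
rewrite act_cat E IH.
by congr (inl (_, _)); last (do 2 case: ifP); lia.
Qed.

Lemma act_wA (e x z : int) :
  act base (inl (x, z)) (wA e) = inl (1 - e - x, if evenz e then z else 2 - z).
Proof.
rewrite act_cat act_wpow21 act_2 /evenz.
by congr (inl (_, _)); last (do 2 case: ifP); lia.
Qed.

Lemma act_wB (e x z : int) :
  act base (inl (x, z)) (wB e) = inl (- e - x, if evenz e then 2 - z else z).
Proof.
rewrite act_cat act_wpow21 act_2 /evenz.
by congr (inl (_, _)); last (do 2 case: ifP); lia.
Qed.

(** On Z the word B is the identity or, like 1, the reflection in 1. It occurs twice, so it cancels,
    and the block is a translation whatever the parity of e. *)
Lemma act_232B1B (e x z : int) :
  act base (inl (x, z)) ([:: g2; g3; g2] ++ wB e ++ [:: g1] ++ wB e) =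
  inl (x + (2 - 2 * e), z + 2).
Proof.
rewrite act_cat act_232 act_cat act_wB act_cat act_1 act_wB.
by congr (inl (_, _)); last case: (evenz e); lia.
Qed.

Lemma act_232A1A (e x z : int) :
  act base (inl (x, z)) ([:: g2; g3; g2] ++ wA e ++ [:: g1] ++ wA e) =
  inl (x + (4 - 2 * e), z + 2).
Proof.
rewrite act_cat act_232 act_cat act_wA act_cat act_1 act_wA.
by congr (inl (_, _)); last case: (evenz e); lia.
Qed.

(** Both blocks are translations, so the exponents multiply their vectors; the exponents in R_2 and
    R_3 are nonnegative when 0 < p < q. *)
Lemma act_wBA (e x z m n : int) : 0 <= m -> 0 <= n ->
  act base (inl (x, z)) (wBA e m n) =
  inl (x + m * (2 - 2 * e) + n * (4 - 2 * e), z + 2 * m + 2 * n).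
Proof.
case: m n => m // [] n // _ _; rewrite /wBA act_cat /wpow.
rewrite (act_flatten_nseq _ _ _ (act_232B1B e)).
rewrite (act_flatten_nseq _ _ _ (act_232A1A e)).
by congr (inl (_, _)); lia.
Qed.

(** For odd q, R_2 and R_3 identify (0, 0) with (w, q) and (- w, q); the exponents m and n of the
    blocks satisfy 2 m + 2 n + 1 = q. *)
Lemma act_R2_odd_odd (p q e : int) :
  0 < p -> p < q -> ~~ evenz p -> ~~ evenz q ->
  act base (base g1)
    (wA e ++ wBA e (halfz (q - p)) (halfz (p - 1)) ++ [:: g2]) =
  inl ((e - 1) * q - p, q).
Proof.
move=> hp hpq pp pq; rewrite /evenz in pp pq.
have hm : 2 * halfz (q - p) = q - p by rewrite /halfz; lia.
have hn : 2 * halfz (p - 1) = p - 1 by rewrite /halfz; lia.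
rewrite act_cat act_wA act_cat act_wBA; try lia.
rewrite act_2.
move: (halfz (q - p)) (halfz (p - 1)) hm hn => m n hm hn.
have -> : q = 2 * m + 2 * n + 1 by lia.
have -> : p = 2 * n + 1 by lia.
by congr (inl (_, _)); last (try case: (evenz e)); lia.
Qed.

Lemma act_R3_odd_odd (p q e : int) :
  0 < p -> p < q -> ~~ evenz p -> ~~ evenz q ->
  act base (base g1)
    (wB e ++ wBA e (halfz (q - p - 2)) (halfz (p + 1))) =
  inl (- ((e - 1) * q - p), q).
Proof.
move=> hp hpq pp pq; rewrite /evenz in pp pq.
have hm : 2 * halfz (q - p - 2) = q - p - 2 by rewrite /halfz; lia.
have hn : 2 * halfz (p + 1) = p + 1 by rewrite /halfz; lia.
rewrite act_cat act_wB act_wBA; try lia.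
move: (halfz (q - p - 2)) (halfz (p + 1)) hm hn => m n hm hn.
have -> : q = 2 * m + 2 * n + 1 by lia.
have -> : p = 2 * n - 1 by lia.
by congr (inl (_, _)); last (try case: (evenz e)); lia.
Qed.

Lemma act_R2_even_odd (p q e : int) :
  0 < p -> p < q -> evenz p -> ~~ evenz q ->
  act base (base g1)
    (wB e ++ wBA e (halfz (q - p - 1)) (halfz p) ++ [:: g2]) =
  inl ((e - 1) * q - p, q).
Proof.
move=> hp hpq pp pq; rewrite /evenz in pp pq.
have hm : 2 * halfz (q - p - 1) = q - p - 1 by rewrite /halfz; lia.
have hn : 2 * halfz p = p by rewrite /halfz; lia.
rewrite act_cat act_wB act_cat act_wBA; try lia.
rewrite act_2.
move: (halfz (q - p - 1)) (halfz p) hm hn => m n hm hn.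
have -> : q = 2 * m + 2 * n + 1 by lia.
have -> : p = 2 * n by lia.
by congr (inl (_, _)); last (try case: (evenz e)); lia.
Qed.

Lemma act_R3_even_odd (p q e : int) :
  0 < p -> p < q -> evenz p -> ~~ evenz q ->
  act base (base g1)
    (wA e ++ wBA e (halfz (q - p - 1)) (halfz p)) =
  inl (- ((e - 1) * q - p), q).
Proof.
move=> hp hpq pp pq; rewrite /evenz in pp pq.
have hm : 2 * halfz (q - p - 1) = q - p - 1 by rewrite /halfz; lia.
have hn : 2 * halfz p = p by rewrite /halfz; lia.
rewrite act_cat act_wA act_wBA; try lia.
move: (halfz (q - p - 1)) (halfz p) hm hn => m n hm hn.
have -> : q = 2 * m + 2 * n + 1 by lia.
have -> : p = 2 * n by lia.
by congr (inl (_, _)); last (try case: (evenz e)); lia.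
Qed.

Lemma act_R2_odd_even (p q e : int) :
  0 < p -> p < q -> ~~ evenz p -> evenz q ->
  act base (base g3)
    (g2 :: wBA e (halfz (q - p - 1)) (halfz (p + 1))) =
  inl (- ((e - 1) * q - p), q).
Proof.
move=> hp hpq pp pq; rewrite /evenz in pp pq.
have hm : 2 * halfz (q - p - 1) = q - p - 1 by rewrite /halfz; lia.
have hn : 2 * halfz (p + 1) = p + 1 by rewrite /halfz; lia.
rewrite -cat1s act_cat act_2 act_wBA; try lia.
move: (halfz (q - p - 1)) (halfz (p + 1)) hm hn => m n hm hn.
have -> : q = 2 * m + 2 * n by lia.
have -> : p = 2 * n - 1 by lia.
by congr (inl (_, _)); last (try case: (evenz e)); lia.
Qed.

(** The base point is now 1 = (0, 1). The closing B reflects Z in 1 exactly for even e, which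
    decides between the lattice vectors (w, - q) and (w, q). *)
Lemma act_R3_odd_even (p q e : int) :
  0 < p -> p < q -> ~~ evenz p -> evenz q ->
  act base (base g1)
    (wA e ++ wBA e (halfz (q - p + 1)) (halfz (p - 1)) ++ wB e) =
  inl ((e - 1) * q - p, if evenz e then 1 - q else 1 + q).
Proof.
move=> hp hpq pp pq; rewrite /evenz in pp pq.
have hm : 2 * halfz (q - p + 1) = q - p + 1 by rewrite /halfz; lia.
have hn : 2 * halfz (p - 1) = p - 1 by rewrite /halfz; lia.
rewrite act_cat act_wA act_cat act_wBA; try lia.
rewrite act_wB.
move: (halfz (q - p + 1)) (halfz (p - 1)) hm hn => m n hm hn.
have -> : q = 2 * m + 2 * n by lia.
have -> : p = 2 * n + 1 by lia.
by congr (inl (_, _)); last case: (evenz e); lia.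
Qed.


(** * The relators generate exactly the lattice *)

Lemma rel123_lattice (p q e : int) s t : 0 < p -> p < q ->
  rel123 p q e s t ->
  lattice_eq ((e - 1) * q - p) q (eval base s) (eval base t).
Proof.
move=> hp hpq; have eqr u v : u = v -> lattice_eq ((e - 1) * q - p) q u v.
  by move=> ->; apply: lattice_eq_refl.
case=> [|pp pq|pp pq|pp pq|pp pq|pp pq|pp pq]; rewrite ?eval_texp.
- exact: eqr.
- by rewrite act_R2_odd_odd //; exists 1, 0; split; rewrite /=; ring.
- by rewrite act_R3_odd_odd //; exists 0, (- 1); split; rewrite /=; ring.
- by rewrite act_R2_even_odd //; exists 1, 0; split; rewrite /=; ring.
- by rewrite act_R3_even_odd //; exists 0, (- 1); split; rewrite /=; ring.
- by rewrite act_R2_odd_even //; exists 0, (- 1); split; rewrite /=; ring.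
- rewrite act_R3_odd_even //; case: (evenz e).
    by exists 0, 1; split; rewrite /=; ring.
  by exists 1, 0; split; rewrite /=; ring.
Qed.

(** Identified points act alike, so the composite of their point reflections, the translation by
    twice their difference, acts trivially. *)
Lemma translate_eq (Q : invQuandle) (F : R1_quandle -> Q) a b c d x z x' z' :
  qhom F -> F (inl (a, b)) = F (inl (c, d)) ->
  x' = x + 2 * (c - a) -> z' = z + 2 * (d - b) ->
  F (inl (x', z')) = F (inl (x, z)).
Proof.
move=> hF ab -> ->; rewrite -[RHS](qop_invol _ (F (inl (a, b)))) {2}ab -!hF /=.
by congr (F (inl (_, _))); lia.
Qed.

(** Pairs of point reflections transport the identification to all even [x] with [z - c] even; the
    reflection 2 then reaches the odd [x] and reverses the sign of [a]. *)
Lemma translate_both (Q : invQuandle) (F : R1_quandle -> Q) c a b x z :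
  qhom F -> F (inl (0, c)) = F (inl (a, c + b)) -> evenz (z - c) ->
  F (inl (x, z)) = F (inl (if evenz x then x + a else x - a, z + b)).
Proof.
move=> hF E; rewrite /evenz => zc.
have tr i j : F (inl (2 * i, c + 2 * j)) = F (inl (a + 2 * i, c + b + 2 * j)).
  have /(congr1 (fun u => qop u (F (inl (i, j))))) :=
    congr1 (fun u => qop u (F (inl (0, 0)))) E.
  rewrite -!hF /= => {}E; move: E.
  by congr (F (inl (_, _)) = F (inl (_, _))); lia.
have [j ->] : exists j, z = c + 2 * j by exists ((z - c) %/ 2)%Z; lia.
case: ifP => xe.
  have [i ->] : exists i, x = 2 * i by exists (x %/ 2)%Z; lia.
  by rewrite tr; congr (F (inl (_, _))); lia.
have [i ->] : exists i, x = - 1 - 2 * i by exists ((- 1 - x) %/ 2)%Z; lia.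
have := congr1 (fun u => qop u (F (inr 0))) (tr i j); rewrite -!hF /=.
by congr (F (inl (_, _)) = F (inl (_, _))); lia.
Qed.

(** As [a] is odd, a second use of [translate_both] undoes the shift by [a] and leaves (0, 2 b).
    With the translation by (2 a, 2 b) this gives (2 a, 0), and the signs of [a] and [b] become
    immaterial. *)
Lemma translate_even (Q : invQuandle) (F : R1_quandle -> Q) c a b x z :
  qhom F -> F (inl (0, c)) = F (inl (a, c + b)) -> ~~ evenz a -> evenz b ->
  evenz (z - c) ->
  F (inl (x, z)) = F (inl (x + a, z + b)) /\
  F (inl (x, z)) = F (inl (x + a, z - b)).
Proof.
rewrite /evenz => hF E oa eb zc.
have tr x' z' : evenz (z' - c) ->
    F (inl (x', z')) = F (inl (if evenz x' then x' + a else x' - a, z' + b)).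
  exact: translate_both.
have e2b x' z' : evenz (z' - c) -> F (inl (x', z' + 2 * b)) = F (inl (x', z')).
  move=> zc'; have zc1 : evenz (z' + b - c) by rewrite /evenz in zc' *; lia.
  rewrite [RHS]tr // [RHS]tr //.
  congr (F (inl (_, _))); last lia.
  by rewrite /evenz; do ![case: ifP]; lia.
have e2a x' z' : evenz (z' - c) -> F (inl (x' + 2 * a, z')) = F (inl (x', z')).
  move=> zc'; rewrite -e2b //; apply: (translate_eq hF E); lia.
have P : F (inl (x, z)) = F (inl (x + a, z + b)).
  rewrite tr //; case: ifP => // _; rewrite -e2a; last by rewrite /evenz; lia.
  by congr (F (inl (_, _))); lia.
split=> //; rewrite P -[RHS]e2b; last by rewrite /evenz; lia.
by congr (F (inl (_, _))); lia.
Qed.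

(** For even [z], both signs of [a] are available from [translate_both]. For odd [z], the height
    [z - b] is even, and [translate_eq] supplies the doubled vectors. *)
Lemma translate_odd (Q : invQuandle) (F : R1_quandle -> Q) a b x z :
  qhom F -> F (inl (0, 0)) = F (inl (a, b)) ->
  F (inl (0, 0)) = F (inl (- a, b)) -> ~~ evenz b ->
  F (inl (x, z)) = F (inl (x + a, z + b)) /\
  F (inl (x, z)) = F (inl (x + a, z - b)).
Proof.
rewrite /evenz => hF E E' ob.
have tr x' z' : evenz z' ->
    F (inl (x', z')) = F (inl (x' + a, z' + b)) /\
    F (inl (x', z')) = F (inl (x' - a, z' + b)).
  move=> ez; have ez0 : evenz (z' - 0) by rewrite subr0.
  have := @translate_both _ F 0 a b x' z' hF; rewrite add0r => /(_ E ez0).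
  have := @translate_both _ F 0 (- a) b x' z' hF; rewrite add0r => /(_ E' ez0).
  by rewrite opprK; case: (evenz x').
have t1 := translate_eq hF E; have t2 := translate_eq hF E'.
have [ez|oz] := boolP (evenz z).
  split; first by have [] := tr x z ez.
  by have [_ ->] := tr x z ez; apply: t2; lia.
split.
  rewrite [RHS](@t1 (x - a) (z - b)); try lia.
  have [|-> _] := tr (x - a) (z - b); first by rewrite /evenz in oz *; lia.
  by rewrite !subrK.
have [|_ ->] := tr (x + a) (z - b); first by rewrite /evenz in oz *; lia.
by rewrite addrK subrK.
Qed.

Lemma rel123_invariant (p q e : int) (Q : invQuandle) (F : R1_quandle -> Q)
    (g : gen -> Q) :
  0 < p -> p < q -> coprimez p q -> qhom F -> (forall l, F (base l) = g l) ->
  (forall s t, rel123 p q e s t -> eval g s = eval g t) ->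
  forall u v, lattice_eq ((e - 1) * q - p) q u v -> F u = F v.
Proof.
move=> hp hpq cop hF Fb Fr; set w := (e - 1) * q - p.
have FR s t : rel123 p q e s t -> F (eval base s) = F (eval base t).
  move=> /Fr; rewrite !(eval_qhom _ _ hF).
  by have -> : F \o base = g by apply/funext.
have inv : (forall x z, F (inl (x, z)) = F (inl (x + w, z + q)) /\
    F (inl (x, z)) = F (inl (x + w, z - q))) ->
    forall u v, lattice_eq w q u v -> F u = F v.
  move=> H; apply: lattice_eq_invariant => [x z|x z|k].
  - by have [] := H x z.
  - by have [] := H x z.
  (* Acting by (0, 0) and by (w, q) on the element 1 - k of the class of 2 gives k and k + 2 w. *)
  - have [+ _] := H 0 0.
    move=> /(congr1 (qop (F (inr (1 - k))))); rewrite -!hF /=.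
    by congr (F (inr _) = F (inr _)); lia.
apply: inv => x z.
case: (boolP (evenz q)) => pq; last first.
  apply: translate_odd => //.
    case: (boolP (evenz p)) => pp.
      have := FR _ _ (rel_R2_even_odd e pp pq).
      by rewrite !eval_texp act_R2_even_odd.
    have := FR _ _ (rel_R2_odd_odd e pp pq).
    by rewrite !eval_texp act_R2_odd_odd.
  case: (boolP (evenz p)) => pp.
    have := FR _ _ (rel_R3_even_odd e pp pq).
    by rewrite !eval_texp act_R3_even_odd.
  have := FR _ _ (rel_R3_odd_odd e pp pq).
  by rewrite !eval_texp act_R3_odd_odd.
have pp : ~~ evenz p.
  apply/negP => pp; have : (2 %| gcdz p q)%Z by rewrite dvdz_gcd; apply/andP.
  by rewrite (eqP cop).
have ow : ~~ evenz w by rewrite /w /evenz in pp pq *; lia.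
have := FR _ _ (rel_R2_odd_even e pp pq).
rewrite !eval_texp act_R2_odd_even // -/w => R2.
have := FR _ _ (rel_R3_odd_even e pp pq).
rewrite !eval_texp act_R3_odd_even // -/w => R3.
(* R_2 starts at height 0 and settles the even heights, R_3 starts at height 1 and settles the odd
   ones; q is even, so these parities are kept. *)
have [ez|oz] := boolP (evenz z).
  have tr x' z' := @translate_even _ F 0 (- w) q x' z' hF.
  rewrite add0r in tr.
  have [||_ P] := tr (x + w) (z + q) R2 _ pq.
  - by rewrite /evenz in ow *; lia.
  - by rewrite /evenz in ez pq *; lia.
  have [||M _] := tr (x + w) (z - q) R2 _ pq.
  - by rewrite /evenz in ow *; lia.
  - by rewrite /evenz in ez pq *; lia.
  by rewrite P M !addrK subrK.
have ez1 : evenz (z - 1) by rewrite /evenz in oz *; lia.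
case: (evenz e) R3 => R3.
  have [|P M] := @translate_even _ F 1 w (- q) x z hF R3 ow _ ez1.
    by rewrite /evenz in pq *; lia.
  by rewrite opprK in M.
exact: (@translate_even _ F 1 w q x z hF R3 ow pq ez1).
Qed.

Definition quotient_of (w q : int) (Q : invQuandle) (g : gen -> Q)
    (F : R1_quandle -> Q) : Prop :=
  [/\ qhom F, forall l, F (base l) = g l, forall y, exists u, F u = y &
      forall u v, F u = F v <-> lattice_eq w q u v].

(** Lattice translates are identified by [rel123_invariant]. Nothing else is, because the quotient
    by the lattice satisfies the relators. *)
Lemma presented_lattice (p q e : int) (Q : invQuandle) (g : gen -> Q) :
  0 < p -> p < q -> coprimez p q -> presented (rel123 p q e) g ->
  exists F : R1_quandle -> Q, quotient_of ((e - 1) * q - p) q g F.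
Proof.
move=> hp hpq cop gP.
have Fr s t : rel123 p q e s t -> eval g s = eval g t by apply: presented_rel.
have [|F [hF Fb]] := @R1_universal Q g; first exact: (Fr _ _ (rel_R1 p q e)).
have evF t : eval g t = F (eval base t).
  by rewrite (eval_qhom _ _ hF); congr eval; apply/funext => l; rewrite -Fb.
exists F; split=> // [y|u v].
  by have [t <-] := gP.1 y; exists (eval base t).
split; last exact: rel123_invariant Fr u v.
have [M [c [hc _ cE]]] := lattice_quotient ((e - 1) * q - p) q.
have [t <-] : exists t, eval base t = u.
  elim/R1_ind: u => [l|l u [t <-]]; first by exists (Gen l).
  by exists (Op t (Gen l)).
have [s <-] : exists s, eval base s = v.
  elim/R1_ind: v => [l|l v [s <-]]; first by exists (Gen l).
  by exists (Op s (Gen l)).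
rewrite -!evF => ts; apply/cE; rewrite !(eval_qhom _ _ hc).
apply: presented_lift gP _ ts => s' t' /(rel123_lattice hp hpq) /cE.
by rewrite !(eval_qhom _ _ hc).
Qed.

(** * Quotients of T as components of Cayley graphs *)

Local Notation point := (int * int)%type.

(** At such a vertex the edge labeled 3 leads up and the edge labeled 1 down; at the other vertices
    it is the reverse. *)
Definition up (v : point) : bool := (v.2 %% 4 == 1)%Z.

(** The edge labeled 2 at [v] goes to the right. *)
Definition right (v : point) : bool := ((v.2 - 1 - 2 * v.1) %% 4 == 0)%Z.

Definition step (l : gen) (v : point) : point :=
  match l with
  | g1 => (v.1, if up v then v.2 - 2 else v.2 + 2)
  | g2 => (if right v then v.1 + 1 else v.1 - 1, v.2)
  | g3 => (v.1, if up v then v.2 + 2 else v.2 - 2)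
  end.

(** A point of odd height is the lower left or the lower right corner of a translate of the hexagon,
    according to [right]. *)
Lemma vertsP v : verts Tgraph v <-> ~~ evenz v.2.
Proof.
case: v => x y; rewrite /= /evenz; split=> [[m [n [k [mn]]]]|oy].
  rewrite /tau /hex_vertex => -[_ ->].
  by case: (k %% 6)%N => [|[|[|[|[|[|[|k']]]]]]] /=; lia.
case: (boolP (right (x, y))); rewrite /right /= => r.
  exists x, (y - 1), 0%N; split; first by lia.
  by congr (_, _); rewrite /=; lia.
exists (x - 1), (y - 1), 5%N; split; first by lia.
by congr (_, _); rewrite /=; lia.
Qed.

Lemma stepK l v : verts Tgraph v -> step l (step l v) = v.
Proof.
move/vertsP; case: v => x y; rewrite /evenz /= => oy.
by case: l; rewrite /step /up /right /=; do ![case: ifP]; move=> *;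
  congr (_, _); lia.
Qed.

Lemma verts_step l v : verts Tgraph v -> verts Tgraph (step l v).
Proof.
rewrite !vertsP; case: v => x y; rewrite /evenz /= => oy.
by case: l; rewrite /step /up /right /=; do ?[case: ifP]; move=> *; lia.
Qed.

(** T is connected: 1 and 3 move along a column, and 2 passes to a neighboring one. *)
Lemma verts_ind (P : point -> Prop) :
  P (0, 1) -> (forall l v, verts Tgraph v -> P v -> P (step l v)) ->
  forall v, verts Tgraph v -> P v.
Proof.
move=> P0 PS.
have Pup x y : ~~ evenz y -> P (x, y) -> P (x, y + 2).
  move=> oy /[dup] /(PS g1) + /(PS g3); rewrite /step /up /=.
  by case: ifP => _; [move=> _|move=> + _]; apply; apply/vertsP.
have Pdn x y : ~~ evenz y -> P (x, y) -> P (x, y - 2).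
  move=> oy /[dup] /(PS g1) + /(PS g3); rewrite /step /up /=.
  by case: ifP => _; [move=> + _|move=> _]; apply; apply/vertsP.
have Pcol x y y' : ~~ evenz y -> P (x, y) -> ~~ evenz y' -> P (x, y').
  move=> oy Py oy'; rewrite /evenz in oy oy'.
  have -> : y' = y + 2 * ((y' - y) %/ 2)%Z by lia.
  elim/int_step_ind: ((y' - y) %/ 2)%Z => [|n IH|n IH].
  - by rewrite mulr0 addr0.
  - rewrite (_ : y + _ = y + 2 * n + 2); last lia.
    by apply: Pup => //; rewrite /evenz; lia.
  - rewrite (_ : y + _ = y + 2 * n - 2); last lia.
    by apply: Pdn => //; rewrite /evenz; lia.
(* In column x the edge labeled 2 leads right at height 2 x + 1 and left at height 2 x - 1. *)
suff Px x : P (x, 2 * x + 1) /\ P (x, 2 * x - 1).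
  move=> [x y] /vertsP oy; have [P1 _] := Px x.
  by apply: Pcol P1 oy; rewrite /evenz; lia.
elim/int_step_ind: x => [|x [P1 P2]|x [P1 P2]].
- by split=> //; apply: Pcol P0 _.
- have vv : verts Tgraph (x, 2 * x + 1).
    by apply/vertsP; rewrite /evenz /=; lia.
  have := PS g2 _ vv P1; rewrite /step /right /=.
  case: ifP => [_ P3|]; last lia.
  by split; apply: Pcol P3 _; rewrite /evenz; lia.
- have vv : verts Tgraph (x, 2 * x - 1) by apply/vertsP; rewrite /evenz /=; lia.
  have := PS g2 _ vv P2; rewrite /step /right /=.
  case: ifP => [|_ P3]; first lia.
  by split; apply: Pcol P3 _; rewrite /evenz; lia.
Qed.

Lemma edge_vertical x y : ~~ evenz y ->
  edges Tgraph [set (x, y); (x, y + 2)].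
Proof.
rewrite /evenz => oy; case: (boolP (right (x, y))); rewrite /right /= => r.
  exists x, (y - 1), 0%N; split; first by lia.
  by rewrite /tau /=; congr [set (_, _); (_, _)]; lia.
exists (x - 1), (y - 1), 4%N; split; first by lia.
by rewrite setUC /tau /=; congr [set (_, _); (_, _)]; lia.
Qed.

Lemma edge_horizontal x y :
  right (x, y) -> edges Tgraph [set (x, y); (x + 1, y)].
Proof.
rewrite /right /= => r; exists x, (y - 1), 5%N; split; first by lia.
by rewrite setUC /tau /=; congr [set (_, _); (_, _)]; lia.
Qed.

Lemma edgesP a :
  edges Tgraph a <-> exists l v, verts Tgraph v /\ a = [set v; step l v].
Proof.
split=> [[m [n [k [mn ->]]]]|[l [[x y] [/vertsP vv ->]]]]; last first.
  rewrite /evenz /= in vv; case: l; rewrite /step /=.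
  - case: ifP => _; last exact: edge_vertical.
    have := @edge_vertical x (y - 2); rewrite subrK setUC; apply.
    by rewrite /evenz; lia.
  - case: ifP => r; first exact: edge_horizontal.
    have := @edge_horizontal (x - 1) y; rewrite subrK setUC; apply.
    by rewrite /right /= in r *; lia.
  - case: ifP => _; first exact: edge_vertical.
    have := @edge_vertical x (y - 2); rewrite subrK setUC; apply.
    by rewrite /evenz; lia.
have kS : hex_vertex k.+1 = nth (0, 1) hexagon ((k %% 6).+1 %% 6)%N.
  by rewrite /hex_vertex -addn1 -modnDml addn1.
have vert x y y' : y' = y + 2 -> ~~ evenz y -> exists l v,
    verts Tgraph v /\ [set (x, y); (x, y')] = [set v; step l v].
  move=> -> oy; exists (if up (x, y) then g3 else g1), (x, y).
  by split; [apply/vertsP|case: ifP; rewrite /step => ->].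
have hor x x' y : x' = x + 1 -> ~~ evenz y -> right (x, y) -> exists l v,
    verts Tgraph v /\ [set (x, y); (x', y)] = [set v; step l v].
  move=> -> oy r; exists g2, (x, y).
  by split; [apply/vertsP|rewrite /step r].
rewrite kS /hex_vertex.
have : (k %% 6 < 6)%N by rewrite ltn_mod.
rewrite /tau; case: (k %% 6)%N => [|[|[|[|[|[|//]]]]]] _ /=.
- by apply: vert; rewrite /evenz; lia.
- by apply: vert; rewrite /evenz; lia.
- rewrite (_ : 0 + m = m); last lia.
  by apply: hor; rewrite /evenz /right /=; lia.
- by rewrite setUC; apply: vert; rewrite /evenz; lia.
- by rewrite setUC; apply: vert; rewrite /evenz; lia.
- by rewrite setUC; apply: hor; rewrite /evenz /right /=; lia.
Qed.

Lemma set2_eq (T : Type) (a b c d : T) :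
  [set a; b] = [set c; d] -> (a = c /\ b = d) \/ (a = d /\ b = c).
Proof.
move=> E.
have : [set a; b] a by left.
have : [set a; b] b by right.
have : [set a; b] c by rewrite E; left.
have : [set a; b] d by rewrite E; right.
rewrite {3 4}E /= => -[] -> [] -> [] E1 [] E2; subst; auto.
Qed.

Lemma lab_step l l' v :
  verts Tgraph v -> lab Tgraph [set v; step l v] l' <-> l = l'.
Proof.
move/vertsP; case: v => x y; rewrite /evenz /= => oy; split.
  move=> [x0 [y0]]; case: l; case: l' => //; rewrite /step /up /right /=;
    try match goal with |- _ /\ _ -> _ => case=> ? end;
    case: ifP => ? ab; have [[[? ?] [? ?]]|[[? ?] [? ?]]] := set2_eq ab; lia.
move=> <-; case: l; rewrite /step /up /right /=; case: ifP => r.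
- by exists x, y; split; [lia|rewrite setUC].
- by exists x, (y + 2); split; [lia|rewrite addrK].
- by exists x, y.
- by exists (x - 1), y; rewrite subrK setUC.
- by exists x, (y + 2); split; [lia|rewrite addrK].
- by exists x, y; split; [lia|rewrite setUC].
Qed.

(** * Automorphisms of T and their orbits *)

Definition automorphic (f : point -> point) : Prop :=
  (forall v, verts Tgraph (f v) <-> verts Tgraph v) /\
  (forall l v, verts Tgraph v -> f (step l v) = step l (f v)).

Lemma automorphic_generated (S : set (point -> point)) f :
  (forall s, S s -> automorphic s) -> generated S f -> automorphic f.
Proof.
move=> aS; elim=> {f} [f|//|f h _ [f1 f2] _ [h1 h2]|f h _ [f1 f2] fK hK].
- exact: aS.
- split=> [v|l v vv]; first exact: iff_trans (f1 _) (h1 _).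
  by rewrite [LHS]/= h2 // f2 // h1.
- split=> [v|l v vv]; first by rewrite -f1 hK.
  by rewrite -[v in LHS]hK -f2 ?fK // -f1 hK.
Qed.

Lemma invariant_generated (T : Type) (S : set (point -> point))
    (k : point -> T) f :
  (forall s, S s -> automorphic s) ->
  (forall s, S s -> forall v, verts Tgraph v -> k (s v) = k v) ->
  generated S f -> forall v, verts Tgraph v -> k (f v) = k v.
Proof.
move=> aS kS; elim=> {f} [f|//|f h gf kf gh kh|f h gf kf fK hK] v vv.
- exact: kS.
- by rewrite /= kf ?kh //; apply/(automorphic_generated aS gh).1.
- rewrite -[v in RHS]hK kf //.
  by apply/(automorphic_generated aS gf).1; rewrite hK.
Qed.

(* [k] identifies the quotient of the vertices of T with an orbit of [Q]. *)
Lemma T_quotientP (Q : invQuandle) (g : gen -> Q) (i : gen) (k : point -> Q)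
    (S : set (point -> point)) :
  k (0, 1) = g i ->
  (forall l v, verts Tgraph v -> k (step l v) = qop (k v) (g l)) ->
  (forall s, S s -> automorphic s) ->
  (forall s, S s -> forall v, verts Tgraph v -> k (s v) = k v) ->
  (forall u v, verts Tgraph u -> verts Tgraph v -> k u = k v ->
     exists2 f, generated S f & f u = v) ->
  is_T_quotient (component (cayley g) (g i)) (g i) S.
Proof.
move=> k0 kS aS kinv korb.
have aG f := @automorphic_generated S f aS.
have kG f := @invariant_generated _ S k f aS kinv.
have vv0 : verts Tgraph (0, 1) by apply/vertsP.
(* A vertex goes to its fiber under [k], an orbit by hypothesis; an edge goes to the set of edges of
   T that have its label and lie over its endpoints. *)
pose F (y : Q) : set point := [set v | verts Tgraph v /\ k v = y].
pose H (a : gen * set Q) : set (set point) :=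
  [set b | exists v,
     [/\ verts Tgraph v, b = [set v; step a.1 v] & k @` b = a.2]].
have orbE v : verts Tgraph v -> vert_orbit S v = F (k v).
  move=> vv; apply/seteqP; split=> [_ [f gf <-]|u [vu /esym ku]].
    by split; [apply/(aG f gf).1|apply: kG].
  by have [f gf <-] := korb _ _ vv vu ku; exists f.
have Finj u v : verts Tgraph u -> F (k u) = F v -> k u = v.
  by move=> vu /seteqP[/(_ u (conj vu erefl))[]].
have im2 l v : verts Tgraph v ->
    k @` [set v; step l v] = [set k v; qop (k v) (g l)].
  by move=> vv; rewrite image_setU !image_set1 kS.
have edge_orbE l v : verts Tgraph v ->
    edge_orbit S [set v; step l v] = H (l, [set k v; qop (k v) (g l)]).
  move=> vv; apply/seteqP; split=> [_ [f gf <-]|b [u [vu -> /=]]].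
    have vf : verts Tgraph (f v) by apply/(aG f gf).1.
    exists (f v); split=> //=.
      by rewrite image_setU !image_set1 (aG f gf).2.
    by rewrite image_setU !image_set1 (aG f gf).2 // im2 // kG.
  have orb u' : verts Tgraph u' -> k u' = k v ->
      edge_orbit S [set v; step l v] [set u'; step l u'].
    move=> vu' /esym kvu; have [f gf <-] := korb _ _ vv vu' kvu.
    by exists f => //; rewrite image_setU !image_set1 (aG f gf).2.
  rewrite im2 // => kuv; have [[ku _]|[ku _]] := set2_eq kuv; first exact: orb.
  (* Here the edge is matched with its ends exchanged, so it is described from its other end. *)
  have -> : [set u; step l u] = [set step l u; step l (step l u)].
    by rewrite stepK // setUC.
  apply: orb; first exact: verts_step.
  by rewrite kS // ku qop_invol.
have conn v : verts Tgraph v -> connected_to (cayley g) (g i) (k v).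
  move: v; apply: verts_ind => [|l v vv IH].
    by rewrite k0; apply: conn_refl.
  apply: (conn_step IH (a := (l, [set k v; qop (k v) (g l)]))).
  - by exists (k v), l.
  - by left.
  - by rewrite /= kS //; right.
have conn_inv y : connected_to (cayley g) (g i) y ->
    exists2 v, verts Tgraph v & k v = y.
  elim=> [|a u v _ [u' vu' <-] [x [l ->]] /= ux vx]; first by exists (0, 1).
  case: vx => ->; case: ux => kx.
  - by exists u'.
  - by exists (step l u'); [exact: verts_step|rewrite kS // kx qop_invol].
  - by exists (step l u'); [exact: verts_step|rewrite kS // kx].
  - by exists u'.
have edgeE a : edges (component (cayley g) (g i)) a ->
    exists l v, verts Tgraph v /\ a = (l, [set k v; qop (k v) (g l)]).
  move=> [[x [l ->]]] [y /= xy /conn_inv[v vv kv]]; exists l.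
  case: xy => yx; first by exists v; rewrite kv yx.
  exists (step l v); split; first exact: verts_step.
  by rewrite kS // kv yx qop_invol.
exists F, H; split.
- split.
  + move=> y [_ /conn_inv[v vv <-]]; exists v => //; exact: orbE.
  + move=> y z /set_mem[_ /conn_inv[v vv <-]] _; exact: Finj.
  + move=> _ [v vv <-]; exists (k v); last by rewrite orbE.
    by split=> //; apply: conn.
- split.
  + move=> a /edgeE[l [v [vv ->]]]; rewrite -edge_orbE //.
    by exists [set v; step l v] => //; apply/edgesP; exists l, v.
  + move=> a b /set_mem/edgeE[l [v [vv ->]]].
    move=> /set_mem/edgeE[l' [v' [vv' ->]]] ab.
    have : H (l, [set k v; qop (k v) (g l)]) [set v; step l v].
      by exists v; split=> //=; rewrite im2.
    rewrite ab => -[u [vu /= e1]]; rewrite im2 // => ->; congr (_, _).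
    by apply/lab_step; [exact: vv|]; rewrite e1; apply/lab_step.
  + move=> _ [a /edgesP[l [v [vv ->]]] <-].
    exists (l, [set k v; qop (k v) (g l)]).
      split; first by exists (k v), l.
      by exists (k v); [left|apply: conn].
    by rewrite edge_orbE.
- by rewrite orbE // k0.
- move=> a l /edgeE[l' [v [vv ->]]] /=; rewrite -edge_orbE //; split=> [->|].
    exists [set v; step l v]; last exact/lab_step.
    by exists id; [exact: gen_id|rewrite image_id].
  move=> [_ [f gf <-]]; rewrite image_setU !image_set1 (aG f gf).2 //.
  by move/lab_step; apply; apply/(aG f gf).1.
- move=> a y /edgeE[l [v [vv ->]]] [_ /conn_inv[u vu <-]] /=; split.
    move=> kuv; exists [set v; step l v].
    have Hb : H (l, [set k v; qop (k v) (g l)]) [set v; step l v].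
      by exists v; split=> //=; rewrite im2.
    case: kuv => ->.
      by exists v; split=> //; [left|rewrite orbE].
    exists (step l v); split=> //; first by right.
    by rewrite orbE ?kS //; apply: verts_step.
  move=> [b [u' [[v' [vv' be /= be2]] bu' Fu]]].
  have vu' : verts Tgraph u'.
    by move: bu'; rewrite be => -[] ->; [|apply: verts_step].
  have <- : k u' = k u by rewrite orbE // in Fu; apply/esym/Finj.
  by move: be2 => /seteqP[+ _]; apply; exists u'.
Qed.

(** On vertices, the image of [base i] under the word read along any path of T from (0, 1) to [v],
    by [pos_step]; the signs record the directions of the edges at [v]. *)
Definition pos (i : gen) (v : point) : R1_quandle :=
  let x := if right v then v.1 else - v.1 in
  match i with
  | g1 => inl (x, if up v then ((v.2 + 1) %/ 2)%Z else ((1 - v.2) %/ 2)%Z)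
  | g2 => inr (if right v then v.1 else 1 - v.1)
  | g3 => inl (x, if up v then ((v.2 - 1) %/ 2)%Z else ((3 - v.2) %/ 2)%Z)
  end.

Lemma pos_step i l v :
  verts Tgraph v -> pos i (step l v) = qop (pos i v) (base l).
Proof.
move/vertsP; case: v => x y; rewrite /evenz /= => oy.
by case: i; case: l; rewrite /pos /step /up /right /=; do ![case: ifP];
  move=> *; first [congr (inl (_, _)) | congr inr]; lia.
Qed.

Lemma automorphic_rho n k : evenz k -> automorphic (rho n k).
Proof.
rewrite /evenz => ek; split=> [v|l [x y] /vertsP].
  by rewrite !vertsP /evenz /=; lia.
rewrite /evenz /= => oy.
by case: l; rewrite /rho /step /up /right /=; do ![case: ifP]; move=> *;
  congr (_, _); lia.
Qed.

Lemma automorphic_phi n : automorphic (phi n).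
Proof.
split=> [v|l [x y] /vertsP]; first by rewrite !vertsP.
rewrite /evenz /= => oy.
by case: l; rewrite /phi /step /up /right /=; do ![case: ifP]; move=> *;
  congr (_, _); lia.
Qed.

Lemma automorphic_tau n : automorphic (tau 0 (4 * n)).
Proof.
split=> [v|l [x y] /vertsP]; first by rewrite !vertsP /evenz /=; lia.
rewrite /evenz /= => oy.
by case: l; rewrite /tau /step /up /right /=; do ![case: ifP]; move=> *;
  congr (_, _); lia.
Qed.

Lemma automorphic_gamma n m : automorphic (gamma n m).
Proof.
have [t1 t2] := automorphic_tau n; have [p1 p2] := automorphic_phi m.
split=> [v|l v vv]; first exact: iff_trans (t1 _) (p1 _).
by rewrite /gamma p2 // t2 //; apply/p1.
Qed.

Lemma generated_tau_mul (S : set (point -> point)) a b n :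
  generated S (tau a b) -> generated S (tau (n * a) (n * b)).
Proof.
move=> Sab; have comp c d c' d' : tau c d \o tau c' d' = tau (c + c') (d + d').
  by apply/funext=> v; rewrite /tau /=; congr (_, _); lia.
have inv : generated S (tau (- a) (- b)).
  by apply: (gen_inv Sab) => -[x y]; rewrite /tau /=; congr (_, _); lia.
elim/int_step_ind: n => [|n IH|n IH].
- rewrite !mul0r (_ : tau 0 0 = id); first exact: gen_id.
  by apply/funext=> -[x y]; rewrite /tau /= !addr0.
- by rewrite !mulrDl !mul1r -comp; apply: gen_comp.
- by rewrite !mulrBl !mul1r -comp; apply: gen_comp.
Qed.

Lemma generated_translate (S : set (point -> point)) a b i j (u v : point) :
  generated S (tau a 0) -> generated S (tau 0 b) ->
  v.1 = u.1 + i * a -> v.2 = u.2 + j * b -> exists2 f, generated S f & f u = v.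
Proof.
move=> /(@generated_tau_mul _ _ _ i) Sa /(@generated_tau_mul _ _ _ j) Sb e1 e2.
exists (tau (i * a) (i * 0) \o tau (j * 0) (j * b)); first exact: gen_comp.
by case: u v e1 e2 => ? ? [? ?] /= -> ->; rewrite /tau /=; congr (_, _); lia.
Qed.

(** * The components as quotients of T *)

Section Components.

Variables (w q : int) (Q : invQuandle) (g : gen -> Q) (F : R1_quandle -> Q).
Hypothesis FP : quotient_of w q g F.

Lemma T_quotient_pos i (S : set (point -> point)) :
  (forall s, S s -> automorphic s) ->
  (forall s, S s -> forall v, verts Tgraph v ->
     lattice_eq w q (pos i (s v)) (pos i v)) ->
  (forall u v, verts Tgraph u -> verts Tgraph v ->
     lattice_eq w q (pos i u) (pos i v) ->
     exists2 f, generated S f & f u = v) ->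
  is_T_quotient (component (cayley g) (g i)) (g i) S.
Proof.
have [hF Fb _ FE] := FP; move=> aS inv orb.
apply: (T_quotientP (k := fun v => F (pos i v))) => //.
- by rewrite -Fb; congr F; case: i {inv orb}.
- by move=> l v vv; rewrite pos_step // hF Fb.
- by move=> s Ss v vv; apply/FE/inv.
- by move=> u v vu vv /FE; apply: orb.
Qed.

(** [pos g2] forgets the height. Up to [phi 0], which flips [right], two vertices over one element
    have equal [right], and then they differ by a combination of (2 w, 0) and (0, 4). *)
Lemma T_quotient_2 :
  is_T_quotient (component (cayley g) (g g2)) (g g2)
    [set tau 0 4; phi 0; phi w].
Proof.
set S := [set _; _; _].
have inv s : S s -> forall v, verts Tgraph v ->
    lattice_eq w q (pos g2 (s v)) (pos g2 v).
  move=> Ss [x y] /vertsP; rewrite /evenz /= => oy.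
  case: Ss => [[->|->]|->]; rewrite /phi /tau /pos /right /=; do ![case: ifP];
    move=> *; first [by exists 0; lia|by exists 1; lia|by exists (- 1); lia].
have aut s : S s -> automorphic s.
  by case=> [[->|->]|->]; rewrite -1?[4]mulr1;
    do ?[exact: automorphic_phi|exact: automorphic_tau].
apply: T_quotient_pos => // u v vu vv uv.
have S0 : S (phi 0) by left; right.
have Sx : generated S (tau (2 * w) 0).
  rewrite (_ : tau _ _ = phi w \o phi 0).
    by apply: gen_comp; apply: gen_in => //; right.
  by apply/funext=> -[x y]; rewrite /tau /phi /=; congr (_, _); lia.
have Sy : generated S (tau 0 4) by apply: gen_in; left; left.
have key u' : verts Tgraph u' -> right u' = right v ->
    lattice_eq w q (pos g2 u') (pos g2 v) ->
    exists2 f, generated S f & f u' = v.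
  move=> /vertsP vu' ruv [i]; rewrite ruv => e.
  apply: (generated_translate (i := if right v then i else - i)
    (j := ((v.2 - u'.2) %/ 4)%Z) Sx Sy).
    by case: (right v) e; lia.
  move: ruv e vu'; move/vertsP: vv; rewrite /evenz /right.
  by do ?[case: ifP]; lia.
have [ruv|ruv] := eqVneq (right u) (right v); first exact: key.
have [|||f Sf <-] := key (phi 0 u).
- exact/(aut _ S0).1.
- by move/vertsP: vu; move: ruv; rewrite /right /evenz /=; lia.
- exact: lattice_eq_trans (inv _ S0 _ vu) uv.
- by exists (f \o phi 0) => //; apply: gen_comp => //; apply: gen_in.
Qed.

(* The sublattice of index 2 spanned by (2 w, 0) and (0, 2 q). *)
Definition rect_eq (u v : R1_quandle) : Prop :=
  match u, v with
  | inl a, inl b =>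
      exists i j, b.1 = a.1 + 2 * w * i /\ b.2 = a.2 + 2 * q * j
  | _, _ => False
  end.

Lemma rect_eq_trans u v t : rect_eq u v -> rect_eq v t -> rect_eq u t.
Proof.
case: u v t => [a|k] [b|l] [c|m] //= [i [j [-> ->]]] [i' [j' [-> ->]]].
by exists (i + i'), (j + j'); split; ring.
Qed.

Lemma rect_lattice_eq u v : rect_eq u v -> lattice_eq w q u v.
Proof.
case: u v => [a|k] [b|l] //= [i [j [-> ->]]].
by exists (i + j), (i - j); split; ring.
Qed.

(** For i = 1, 3, the height of the midpoint of the edge labeled i at (0, 1). The rotation about it
    folds that edge to a loop, as i^i = i requires. *)
Definition center (i : gen) : int := if i is g1 then 0 else 2.

(** For [k] = 0 the rotation preserves [pos i]; in general it also shifts y by 2 q k, hence Z by q k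
    up to sign, a multiple of 2 q. *)
Lemma pos_rho i k v : i <> g2 -> evenz k -> verts Tgraph v ->
  rect_eq (pos i (rho 0 (center i + q * k) v)) (pos i v).
Proof.
rewrite /evenz => i2 ek /vertsP; case: v => x y; rewrite /evenz /= => oy.
have [j ->] : exists j, k = 2 * j by exists (k %/ 2)%Z; lia.
case: i i2 => //= _; rewrite /up /right /=; do ?[case: ifP]; move=> *;
  first [by exists 0, j; lia|by exists 0, (- j); lia].
Qed.

(** The rotation flips [up], so equal [up] may be assumed. Then [right], which depends on y mod 4
    and the parity of x, agrees too, and the signs in [pos] coincide. *)
Lemma rho_orbit i (S : set (point -> point)) u v :
  i <> g2 -> S (rho 0 (center i)) ->
  generated S (tau (2 * w) 0) -> generated S (tau 0 (4 * q)) ->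
  verts Tgraph u -> verts Tgraph v -> rect_eq (pos i u) (pos i v) ->
  exists2 f, generated S f & f u = v.
Proof.
move=> i2 Sr Sx Sy vu vv uv.
have key u' : verts Tgraph u' -> up u' = up v ->
    rect_eq (pos i u') (pos i v) -> exists2 f, generated S f & f u' = v.
  move=> vu' uuv; case: i i2 {Sr uv} => //= _ [a [b [ea eb]]].
  - have ruv : right u' = right v.
      move/vertsP: vu' ea uuv; move/vertsP: vv.
      by rewrite /evenz /up /right; do ?[case: ifP]; lia.
    apply: (generated_translate (i := if right v then a else - a)
      (j := if up v then b else - b) Sx Sy).
      by move: ea; rewrite ruv; case: (right v); lia.
    move/vertsP: vu' eb uuv; move/vertsP: vv.
    by rewrite /evenz /up; do ?[case: ifP]; lia.
  - have ruv : right u' = right v.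
      move/vertsP: vu' ea uuv; move/vertsP: vv.
      by rewrite /evenz /up /right; do ?[case: ifP]; lia.
    apply: (generated_translate (i := if right v then a else - a)
      (j := if up v then b else - b) Sx Sy).
      by move: ea; rewrite ruv; case: (right v); lia.
    move/vertsP: vu' eb uuv; move/vertsP: vv.
    by rewrite /evenz /up; do ?[case: ifP]; lia.
have [uuv|uuv] := eqVneq (up u) (up v); first exact: key.
have [|||f Sf <-] := key (rho 0 (center i) u).
- by apply/(automorphic_rho 0 _).1; case: i {i2 Sr uv key}.
- move/vertsP: vu; move: uuv; rewrite /up /evenz /=.
  by case: i {i2 Sr uv key} => /=; lia.
- apply: rect_eq_trans uv; have := @pos_rho i 0 u i2 isT vu.
  by rewrite mulr0 addr0.
- by exists (f \o rho 0 (center i)) => //; apply: gen_comp => //; apply: gen_in.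
Qed.

Lemma tau_rho (S : set (point -> point)) n k n' k' :
  S (rho n k) -> S (rho n' k') ->
  generated S (tau (2 * (n - n')) (2 * (k - k'))).
Proof.
move=> Snk Snk'.
rewrite (_ : tau _ _ = rho n k \o rho n' k').
  by apply: gen_comp; apply: gen_in.
by apply/funext=> -[x y]; rewrite /tau /rho /=; congr (_, _); lia.
Qed.

Lemma T_quotient_odd : ~~ evenz q ->
  is_T_quotient (component (cayley g) (g g1)) (g g1)
    [set rho 0 0; rho w 0; rho 0 (2 * q)].
Proof.
set S := [set _; _; _]; move=> oq.
have S0 : S (rho 0 0) by left; left.
have Sw : S (rho w 0) by left; right.
have Sq : S (rho 0 (2 * q)) by right.
have n12 : g1 <> g2 by [].
apply: T_quotient_pos => [s|s|u v vu vv uv].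
- by case=> [[->|->]|->]; apply: automorphic_rho; rewrite /evenz; lia.
- case=> [[->|->]|->] v vv; apply: rect_lattice_eq.
  + by have := @pos_rho g1 0 v n12 isT vv; rewrite mulr0.
  + move/vertsP: vv; case: v => x y; rewrite /evenz /= => oy.
    rewrite /up /right /=; do ?[case: ifP]; move=> *;
    first [by exists 1, 0; lia|by exists (- 1), 0; lia].
  + by have := @pos_rho g1 2 v n12 isT vv; rewrite add0r [q * 2]mulrC.
apply: (@rho_orbit g1 S) => //.
- by have := tau_rho Sw S0; rewrite !subr0 mulr0.
- by have := tau_rho Sq S0; rewrite !subr0 mulr0 mulrA.
case: uv => i [j []] /=; move/vertsP: vu; move/vertsP: vv.
rewrite /evenz => vv vu ex ey.
(* On this component Z is always odd, so q (i - j) is even and, as q is odd, so is i - j: the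
   rectangular sublattice suffices. *)
have [k ij] : exists k, i = j + 2 * k.
  exists ((i - j) %/ 2)%Z; rewrite /evenz in oq.
  have [r er] : exists r, q = 2 * r + 1 by exists ((q - 1) %/ 2)%Z; lia.
  by move: ey; rewrite er /up; do ?[case: ifP]; lia.
by exists (j + k), k; rewrite ex ey ij /=; split; ring.
Qed.

Lemma T_quotient_even i : i <> g2 -> ~~ evenz w -> evenz q ->
  is_T_quotient (component (cayley g) (g i)) (g i)
    [set rho 0 (center i); rho 0 (center i + 2 * q);
         gamma (halfz q) (halfz (w - 1))].
Proof.
set S := [set _; _; _]; move=> i2 ow eq.
have S0 : S (rho 0 (center i)) by left; left.
have Sq : S (rho 0 (center i + 2 * q)) by left; right.
pose c v : point := gamma (halfz q) (halfz (w - 1)) v.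
have Sc : S c by right.
(* As w is odd and q even, the axis (w - 1)/2 + 1/2 is w/2, and 4 (q/2) is 2 q. *)
have cE v : c v = (w - v.1, v.2 + 2 * q).
  rewrite /c /gamma /phi /tau /halfz /=; rewrite /evenz in ow eq.
  by congr (_, _); lia.
have ec : evenz (center i) by case: i {i2 S S0 Sq Sc}.
(* The coordinates move by odd multiples of w and q: [c] accounts for the lattice vectors outside
   the rectangular sublattice. *)
have posc v : verts Tgraph v -> exists d d',
    [/\ evenz (d - 1), evenz (d' - 1) &
      if pos i v is inl a then pos i (c v) = inl (a.1 + w * d, a.2 + q * d')
      else False].
  move=> /vertsP; case: v => x y; rewrite cE /evenz /= => vv.
  rewrite /evenz in ow eq; case: i i2 {S S0 Sq Sc ec} => //= _;
    rewrite /up /right /=; do ?[case: ifP]; move=> *;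
    first [by exists 1, 1; split=> //; congr (inl (_, _)); lia
          |by exists (- 1), 1; split=> //; congr (inl (_, _)); lia
          |by exists 1, (- 1); split=> //; congr (inl (_, _)); lia
          |by exists (- 1), (- 1); split=> //; congr (inl (_, _)); lia].
have invc v : verts Tgraph v -> lattice_eq w q (pos i v) (pos i (c v)).
  move=> /posc[d [d' [od od']]]; rewrite /evenz in od od'.
  case: (pos i v) => // a -> /=; exists ((d + d') %/ 2)%Z, ((d - d') %/ 2)%Z.
  by split; congr (_ + _ * _); lia.
have inv s : S s -> forall v, verts Tgraph v ->
    lattice_eq w q (pos i (s v)) (pos i v).
  case=> [[->|->]|->] t vt.
  - apply: rect_lattice_eq; have := @pos_rho i 0 t i2 isT vt.
    by rewrite mulr0 addr0.
  - apply: rect_lattice_eq; have := @pos_rho i 2 t i2 isT vt.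
    by rewrite [q * 2]mulrC.
  - by apply: lattice_eq_sym; apply: invc.
have aut s : S s -> automorphic s.
  case=> [[->|->]|->]; last exact: automorphic_gamma;
    by apply: automorphic_rho; rewrite /evenz in ec *; lia.
apply: T_quotient_pos => // u v vu vv uv.
have Sx : generated S (tau (2 * w) 0).
  (* [c] after the rotation is a horizontal glide reflection by w. *)
  rewrite (_ : tau _ _ = (c \o rho 0 (center i)) \o (c \o rho 0 (center i))).
    by apply: gen_comp; apply: gen_comp; apply: gen_in.
  by apply/funext=> -[x y]; rewrite /= !cE /tau /rho /=; congr (_, _); lia.
have Sy : generated S (tau 0 (4 * q)).
  have := tau_rho Sq S0; rewrite subr0 mulr0 [_ + 2 * q]addrC addrK.
  by rewrite mulrA.
have key u' : verts Tgraph u' -> rect_eq (pos i u') (pos i v) ->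
    exists2 f, generated S f & f u' = v.
  by move=> vu'; apply: (@rho_orbit i S).
have [d [d' [od od' pc]]] := posc _ vu.
case pu : (pos i u) pc uv => [x|//] pcu.
case pv : (pos i v) => [y|//] [a [b [ex ez]]].
rewrite /evenz in od od'.
(* For even a + b the vector lies in the rectangular sublattice; otherwise [c] is applied first. *)
have [|] := boolP (evenz (a + b)); rewrite /evenz => eab.
  apply: key => //; rewrite pu pv.
  exists ((a + b) %/ 2)%Z, ((a - b) %/ 2)%Z; rewrite ex ez -!mulrA.
  by split; congr (_ + _); rewrite mulrCA; congr (_ * _); lia.
have [||f Sf <-] := key (c u); first by apply/(aut _ Sc).1.
  rewrite pcu pv /=.
  exists ((a + b - d) %/ 2)%Z, ((a - b - d') %/ 2)%Z.
  rewrite ex ez -!addrA -!mulrA.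
  split; congr (_ + _); rewrite mulrCA -mulrDr; congr (_ * _); lia.
by exists (f \o c) => //; apply: gen_comp => //; apply: gen_in.
Qed.

End Components.

(** * Connectedness, and the trade of 1 and 3 *)

Lemma connected_trans (V E : Type) (G : lgraph V E) x y z :
  connected_to G x y -> connected_to G y z -> connected_to G x z.
Proof.
by move=> xy; elim=> // a u v _ xu Ga au av; apply: conn_step xu Ga au av.
Qed.

Lemma connected_sym (V E : Type) (G : lgraph V E) x y :
  connected_to G x y -> connected_to G y x.
Proof.
elim=> [|a u v _ ux Ga au av]; first exact: conn_refl.
by apply: connected_trans ux; apply: conn_step (conn_refl _ _) Ga av au.
Qed.

Lemma component_connected (V E : Type) (G : lgraph V E) x y :
  connected_to G x y -> component G x = component G y.
Proof.
move=> xy; rewrite /component.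
suff -> : connected_to G x = connected_to G y by [].
apply/funext=> z; apply/propext; split; apply: connected_trans => //.
exact: connected_sym.
Qed.

Lemma connected_act (Q : invQuandle) (g : gen -> Q) y W :
  connected_to (cayley g) y (act g y W).
Proof.
elim: W y => [|l W IH] y; first exact: conn_refl.
apply: connected_trans (IH _).
apply: (conn_step (conn_refl _ _) (a := (l, [set y; qop y (g l)]))).
- by exists y, l.
- by left.
- by right.
Qed.

Lemma swap13K : involutive swap13.
Proof. by case. Qed.

Lemma trade13_iso (Q : invQuandle) (g : gen -> Q) (s : Q -> Q) i :
  qhom s -> involutive s -> (forall l, s (g l) = g (swap13 l)) ->
  marked_iso (component (cayley g) (g i)) (g i)
    (trade13 (component (cayley g) (g (swap13 i)))) (g (swap13 i)).
Proof.
move=> hs sK sg.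
pose h (a : gen * set Q) := (swap13 a.1, s @` a.2).
have hK : involutive h.
  move=> [l A]; rewrite /h /= swap13K; congr (_, _); rewrite image_comp.
  rewrite (_ : s \o s = id) ?image_id //; exact/funext.
have edge a : edges (cayley g) a -> edges (cayley g) (h a).
  move=> [y [l ->]]; exists (s y), (swap13 l).
  by rewrite /h /= image_setU !image_set1 hs sg.
have conn j y : connected_to (cayley g) (g j) y ->
    connected_to (cayley g) (g (swap13 j)) (s y).
  elim=> [|a u v _ IH Ga au av]; first by rewrite sg; apply: conn_refl.
  by apply: conn_step IH (edge _ Ga) _ _; [exists u|exists v].
have cedge j a : edges (component (cayley g) (g j)) a ->
    edges (component (cayley g) (g (swap13 j))) (h a).
  move=> [Ga [v av cv]]; split; first exact: edge.
  by exists (s v); [exists v|exact: conn].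
exists s, h; split.
- split.
  + by move=> y [_ cy]; split=> //; apply: conn.
  + by move=> y z _ _ /(congr1 s); rewrite !sK.
  + move=> y [_ cy]; exists (s y); last exact: sK.
    by split=> //; rewrite -[i]swap13K; apply: conn.
- split.
  + by move=> a; apply: cedge.
  + by move=> a b _ _ /(congr1 h); rewrite !hK.
  + move=> a ca; exists (h a); last exact: hK.
    by rewrite -[i]swap13K; apply: cedge.
- exact: sg.
- by move=> a l _ /=; split=> [->//|/(congr1 swap13)]; rewrite !swap13K.
- move=> a v _ _ /=; split=> [av|[u au /(congr1 s)]]; first by exists v.
  by rewrite !sK => <-.
Qed.

(** The reflection Z -> 1 - Z exchanges (0, 0) and (0, 1), and also (w, q) and (w, - q), so it
    descends to [Q]. *)
Lemma swap_exists (w q : int) (Q : invQuandle) (g : gen -> Q)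
    (F : R1_quandle -> Q) :
  quotient_of w q g F -> exists s : Q -> Q,
    [/\ qhom s, involutive s & forall l, s (g l) = g (swap13 l)].
Proof.
move=> [hF Fb Fs FE].
pose sw (u : R1_quandle) : R1_quandle :=
  match u with inl a => inl (a.1, 1 - a.2) | inr k => inr k end.
have swK : involutive sw by case=> [[x z]|k] //=; congr (inl (_, _)); lia.
have hsw : qhom sw.
  by case=> [[x z]|k] [[x' z']|k'] //=; congr (inl (_, _)); lia.
have lsw u v : lattice_eq w q u v -> lattice_eq w q (sw u) (sw v).
  case: u v => [a|k] [b|l] //= [i [j [-> ->]]].
  by exists j, i; split; ring.
have [r rK] := choice Fs.
pose s y := F (sw (r y)).
have sF u : s (F u) = F (sw u) by apply/FE/lsw/FE.
exists s; split.
- move=> y z; rewrite -(rK y) -(rK z) -hF !sF -hF; congr F; exact: hsw.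
- by move=> y; rewrite -(rK y) !sF swK.
- by move=> l; rewrite -!Fb sF; case: l.
Qed.

(** * The quandle of a diagram *)

(** Colorings stand for homomorphisms from Q_2 to [Q]; they restrict to tangles and glue along
    common ends. *)
Definition colors (D : diagram) (Q : invQuandle) (x : seg D -> Q) : Prop :=
  (forall a b, (a, b) \in joins D -> x a = x b) /\
  (forall i j k, (i, j, k) \in crossings D -> qop (x k) (x j) = x i).

Lemma colorsP (D : diagram) (Q : invQuandle) (x : seg D -> Q) :
  colors x <-> forall s t, Q2_rel s t -> eval x s = eval x t.
Proof.
split=> [[xj xc] s t|xr]; first by case=> *; [apply: xj|apply: xc].
split=> [a b ab|i j k ijk]; first by apply: (xr (Gen a) (Gen b)); constructor.
by apply: (xr (Op (Gen k) (Gen j)) (Gen i)); constructor.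
Qed.

Lemma colors_qhom (D : diagram) (Q Q' : invQuandle) (f : Q -> Q')
    (x : seg D -> Q) :
  qhom f -> colors x -> colors (f \o x).
Proof.
move=> hf [xj xc]; split=> [a b /xj e|i j k /xc e] /=; first by rewrite e.
by rewrite -hf e.
Qed.

(* Typed injections, so that the segments of nested sums are never compared by
   unfolding. *)
Definition tinl (t1 t2 : tangle) (s : seg t1) : seg (thsum t1 t2) := inl s.
Definition tinr (t1 t2 : tangle) (s : seg t2) : seg (thsum t1 t2) := inr s.
Definition tclose (t : tangle) (s : seg t) : seg (numerator_closure t) := s.

Lemma colors_thsum (t1 t2 : tangle) (Q : invQuandle)
    (x : seg (thsum t1 t2) -> Q) :
  colors x <->
  [/\ colors (fun s => x (tinl t2 s)), colors (fun s => x (tinr t1 s)),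
      x (tinl t2 (ne t1)) = x (tinr t1 (nw t2)) &
      x (tinl t2 (se t1)) = x (tinr t1 (sw t2))].
Proof.
split=> [[xj xc]|[[xj1 xc1] [xj2 xc2] e1 e2]].
  split.
  - split=> [a b ab|i j k ijk].
      apply: xj; rewrite !inE !mem_cat.
      by rewrite (map_f (fun d => (inl d.1, inl d.2)) ab) !orbT.
    apply: xc; rewrite mem_cat.
    by rewrite (map_f (fun c => (inl c.1.1, inl c.1.2, inl c.2)) ijk).
  - split=> [a b ab|i j k ijk].
      apply: xj; rewrite !inE !mem_cat.
      by rewrite (map_f (fun d => (inr d.1, inr d.2)) ab) !orbT.
    apply: xc; rewrite mem_cat.
    by rewrite (map_f (fun c => (inr c.1.1, inr c.1.2, inr c.2)) ijk) orbT.
  - by apply: xj; rewrite !inE eqxx.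
  - by apply: xj; rewrite !inE eqxx orbT.
split=> [a b|i j k].
  rewrite !inE mem_cat => /or3P[/eqP[-> ->] //|/eqP[-> ->] //|/orP[]].
    by move=> /mapP[[a' b'] /xj1 /= e [-> ->]].
  by move=> /mapP[[a' b'] /xj2 /= e [-> ->]].
rewrite mem_cat => /orP[] /mapP[[[i' j'] k'] /= ijk [-> -> ->]].
  exact: (xc1 _ _ _ ijk).
exact: (xc2 _ _ _ ijk).
Qed.

Lemma colors_closure (t : tangle) (Q : invQuandle)
    (x : seg (numerator_closure t) -> Q) :
  colors x <->
  [/\ colors (fun s => x (tclose s)), x (tclose (nw t)) = x (tclose (ne t)) &
      x (tclose (sw t)) = x (tclose (se t))].
Proof.
split=> [[xj xc]|[[xj xc] e1 e2]].
  split.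
  - by split=> // a b ab; apply: xj; rewrite !inE ab !orbT.
  - by apply: xj; rewrite !inE eqxx.
  - by apply: xj; rewrite !inE eqxx orbT.
by split=> // a b; rewrite !inE => /or3P[/eqP[-> ->]|/eqP[-> ->]|/xj].
Qed.

Lemma colors_ttwist (b : bool) (t : tangle) (Q : invQuandle)
    (x : seg (ttwist b t) -> Q) :
  colors x <->
  colors (D := t) (x \o Some) /\
  qop (x None) (x (Some (if b then se t else ne t))) =
    x (Some (if b then ne t else se t)).
Proof.
split=> [[xj xc]|[[xj xc] e]].
  split; last by apply: xc; rewrite inE eqxx.
  split=> [a a' aa|i j k ijk] /=.
    by apply: xj; rewrite /= (map_f (fun d => (Some d.1, Some d.2)) aa).
  apply: xc; rewrite inE.
  by rewrite (map_f (fun c => (Some c.1.1, Some c.1.2, Some c.2)) ijk) orbT.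
split=> [a a' /mapP[[? ?] /xj /= e' [-> ->]] //|i j k].
rewrite inE => /orP[/eqP[-> -> ->] //|/mapP[[[i' j'] k'] /= ijk [-> -> ->]]].
exact: (xc _ _ _ ijk).
Qed.

(** * Colorings of rational tangles *)

(* In the involutory quandle of a rational tangle a / b, free on two
   generators and so isomorphic to [dihedral], the ends NW, NE, SW and SE are
   0, a, b and a + b. *)
Definition tangle_coloring (t : tangle) (a b : int) (c : seg t -> dihedral) :=
  [/\ colors c, c (nw t) = 0,
      [/\ c (ne t) = a, c (sw t) = b & c (se t) = a + b] &
      forall (Q : invQuandle) (x : seg t -> Q), colors x ->
        exists2 h : int -> Q, line h & forall s, x s = h (c s)].

(** The sign [s] is due to rotations: the colors are shifted so that the new NW end, formerly NE,
    gets 0, which negates the pair relative to [slope]. *)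
Lemma rtangle_coloring (r : rdiag) :
  exists (c : seg (rtangle r) -> dihedral) (s : int),
    s * s = 1 /\ tangle_coloring (s * (slope r).1) (s * (slope r).2) c.
Proof.
elim: r => [|r [c [s [ss [cc c0 [ca cb cab] cu]]]]
  |l r [c [s [ss [cc c0 [ca cb cab] cu]]]]].
- exists (fun b : bool => if b then 0 else 1), 1; split=> //.
  split=> // Q x _; have [h [hh h0 h1]] := line_exists (x true) (x false).
  by exists h => // -[].
- exists (fun z => c z - s * (slope r).1), (- s).
  split; first by rewrite mulrNN.
  split=> /=.
  + have [cj cx] := cc; split=> [a b /cj -> //|i j k /cx <- /=]; lia.
  + by rewrite /= ca; lia.
  + by rewrite /= cab c0 cb; split; lia.
  + move=> Q x xc; have [h hh hx] := cu Q x xc.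
    exists (fun n => h (s * (slope r).1 + n * 1)); first exact: line_affine.
    by move=> z; rewrite hx; congr h; lia.
(* The crossing forces the color of the new arc [None]: the undercrossing color reflected in the
   overcrossing one. *)
- exists (fun z => if z is Some z' then c z'
    else if l then s * (slope r).1 + 2 * s * (slope r).2
    else s * (slope r).1 - s * (slope r).2), s; split=> //.
  split.
  + apply/colors_ttwist; split=> //; case: l => /=; rewrite cab ca; lia.
  + exact: c0.
  + by case: l => /=; rewrite ?cab ?ca ?cb; split=> //; lia.
  + move=> Q x /colors_ttwist[xc xn]; have [h hh hx] := cu Q _ xc.
    exists h => // -[z|]; first exact: hx.
    set over := if l then se _ else ne _ in xn.
    move: xn => /(congr1 (fun u => qop u (x (Some over)))).
    rewrite qop_invol => ->.
    have hx' z : x (Some z) = h (c z) by apply: hx.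
    rewrite !hx' -hh; congr h; rewrite /over.
    by case: (l) => /=; rewrite cab ca; lia.
Qed.

Lemma slope_bezout (r : rdiag) :
  exists u v, u * (slope r).1 + v * (slope r).2 = 1.
Proof.
elim: r => [|r [u [v uv]]|b r [u [v uv]]] /=.
- by exists 0, 1.
- by exists (- v), u; rewrite -uv; ring.
- exists u, (if b then v - u else v + u); rewrite -uv.
  by case: b; ring.
Qed.

(** Coprime pairs of equal slope differ by a sign [k], and the coloring is rescaled by the sign
    [k * s]. *)
Lemma rational_coloring (r : rdiag) (a b : int) :
  rational_diagram r a b -> coprimez a b ->
  exists c : seg (rtangle r) -> dihedral, tangle_coloring a b c.
Proof.
rewrite /rational_diagram => ab cop.
have [u [v uv]] := slope_bezout r.
have [c [s [ss [cc c0 [ca cb cab] cu]]]] := rtangle_coloring r.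
set a' := (slope r).1 in ab uv ca cb cab *.
set b' := (slope r).2 in ab uv ca cb cab *.
pose k := u * a + v * b.
have ak : a = k * a'.
  have /= e := congr1 ( *%R v) ab; rewrite /k -[LHS]mulr1 -uv; lia.
have bk : b = k * b'.
  have /= e := congr1 ( *%R u) ab; rewrite /k -[LHS]mulr1 -uv; lia.
have kk : k * k = 1.
  have [u' [v' uv']] : exists u' v', u' * a + v' * b = 1.
    have [u' [v' e]] := Bezoutz a b; exists u', v'; rewrite e; exact/eqP.
  have : (k %| 1)%Z.
    by apply/dvdzP; exists (u' * a' + v' * b'); rewrite -[LHS]uv' ak bk; ring.
  by rewrite dvdz1; lia.
have ksE z : k * s * (s * z) = k * z.
  by rewrite mulrA -[k * s * s]mulrA ss mulr1.
exists (fun z => k * s * c z); split.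
- have [cj cx] := cc; split=> [y z /cj -> //|i j l /cx <- /=]; ring.
- by rewrite c0 mulr0.
- by rewrite ca cb cab -mulrDr !ksE mulrDr -ak -bk.
- move=> Q x xc; have [h hh hx] := cu Q x xc.
  exists (fun n => h (0 + n * (k * s))); first exact: line_affine.
  by move=> z; rewrite hx add0r mulrAC mulrACA kk ss !mul1r.
Qed.

Lemma slope_twist_row (e : int) : slope (twist_row e) = (- e, 1).
Proof.
have it b n : slope (iter n (RTwist b) RZero) =
    (if b then n%:Z else - n%:Z, 1).
  by elim: n => [|n /= ->]; [case: b|case: b => /=; congr (_, _); lia].
by rewrite /twist_row it; congr (_, _); case: ifP; lia.
Qed.

(** * The closed sum of four tangles *)

Lemma line_qhom (Q Q' : invQuandle) (f : Q -> Q') (h : int -> Q) :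
  qhom f -> line h -> line (f \o h).
Proof. by move=> hf hh n m; rewrite /= hh hf. Qed.

Lemma line_inl (Q : invQuandle) (F : R1_quandle -> Q) a b c d :
  qhom F -> line (fun n => F (inl (a + n * b, c + n * d))).
Proof.
by move=> hF n m /=; rewrite -hF /=; congr (F (inl (_, _))); rewrite /=; ring.
Qed.

Lemma line_image (Q : invQuandle) (F : R1_quandle -> Q) (h : int -> Q) u v :
  qhom F -> line h -> h 0 = F u -> h 1 = F v ->
  exists2 l : int -> R1_quandle, [/\ line l, l 0 = u & l 1 = v] &
    forall n, h n = F (l n).
Proof.
move=> hF hh h0 h1; have [l [hl l0 l1]] := line_exists u v.
exists l => //; apply: (@line_eq _ h (F \o l) 0) => //.
- exact: line_qhom.
- by rewrite /= l0.
- by rewrite /= add0r l1.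
Qed.

Fixpoint map_term (X Y : Type) (f : X -> Y) (t : term X) : term Y :=
  match t with
  | Gen x => Gen (f x)
  | Op s t => Op (map_term f s) (map_term f t)
  end.

Lemma eval_map_term (X Y : Type) (Q : invQuandle) (g : Y -> Q) (f : X -> Y) t :
  eval g (map_term f t) = eval (g \o f) t.
Proof. by elim: t => //= s -> t ->. Qed.

Lemma nw_thsum t1 t2 : nw (thsum t1 t2) = tinl t2 (nw t1).
Proof. by []. Qed.

Lemma ne_thsum t1 t2 : ne (thsum t1 t2) = tinr t1 (ne t2).
Proof. by []. Qed.

Lemma sw_thsum t1 t2 : sw (thsum t1 t2) = tinl t2 (sw t1).
Proof. by []. Qed.

Lemma se_thsum t1 t2 : se (thsum t1 t2) = tinr t1 (se t2).
Proof. by []. Qed.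

Local Notation sum_diagram t1 t2 t3 t4 :=
  (numerator_closure (thsum (thsum (thsum t1 t2) t3) t4)).

Definition in1 (t1 t2 t3 t4 : tangle) (s : seg t1) :
  seg (sum_diagram t1 t2 t3 t4) := tclose (tinl t4 (tinl t3 (tinl t2 s))).
Definition in2 (t1 t2 t3 t4 : tangle) (s : seg t2) :
  seg (sum_diagram t1 t2 t3 t4) := tclose (tinl t4 (tinl t3 (tinr t1 s))).
Definition in3 (t1 t2 t3 t4 : tangle) (s : seg t3) :
  seg (sum_diagram t1 t2 t3 t4) := tclose (tinl t4 (tinr (thsum t1 t2) s)).
Definition in4 (t1 t2 t3 t4 : tangle) (s : seg t4) :
  seg (sum_diagram t1 t2 t3 t4) := tclose (tinr (thsum (thsum t1 t2) t3) s).

(* The arcs at the SW and NE ends of the first tangle and at the NE end of the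
   second one. *)
Definition arc (t1 t2 t3 t4 : tangle) (i : gen) :
    seg (sum_diagram t1 t2 t3 t4) :=
  match i with
  | g1 => in1 t2 t3 t4 (sw t1)
  | g2 => in1 t2 t3 t4 (ne t1)
  | g3 => in2 t1 t3 t4 (ne t2)
  end.

Lemma colors_sum (t1 t2 t3 t4 : tangle) (Q : invQuandle)
    (x : seg (sum_diagram t1 t2 t3 t4) -> Q) :
  let x1 s := x (in1 t2 t3 t4 s) in
  let x2 s := x (in2 t1 t3 t4 s) in
  let x3 s := x (in3 t1 t2 t4 s) in
  let x4 s := x (in4 t1 t2 t3 s) in
  colors x <->
  [/\ [/\ colors x1, colors x2, colors x3 & colors x4],
      x1 (ne t1) = x2 (nw t2) /\ x1 (se t1) = x2 (sw t2),
      x2 (ne t2) = x3 (nw t3) /\ x2 (se t2) = x3 (sw t3),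
      x3 (ne t3) = x4 (nw t4) /\ x3 (se t3) = x4 (sw t4) &
      x1 (nw t1) = x4 (ne t4) /\ x1 (sw t1) = x4 (se t4)].
Proof.
have sumE t t' x' := propext (@colors_thsum t t' Q x').
move=> x1 x2 x3 x4; rewrite colors_closure !sumE.
rewrite !(nw_thsum, ne_thsum, sw_thsum, se_thsum).
split=> [[[[[y1 y2 a1 a2] y3 b1 b2] y4 d1 d2] k1 k2]|].
  by split; split.
by move=> [[y1 y2 y3 y4] [a1 a2] [b1 b2] [d1 d2] [k1 k2]]; do 4 split=> //.
Qed.

Section SumDiagram.

Variables (p q e : int) (t1 t2 t3 t4 : tangle).
Hypotheses (hp : 0 < p) (hpq : p < q) (hcop : coprimez p q).
Variables (c1 : seg t1 -> dihedral) (c2 : seg t2 -> dihedral)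
  (c3 : seg t3 -> dihedral) (c4 : seg t4 -> dihedral).
Hypotheses (h1 : tangle_coloring 1 2 c1) (h2 : tangle_coloring 1 2 c2)
  (h3 : tangle_coloring p q c3) (h4 : tangle_coloring (- e) 1 c4).

Let w := (e - 1) * q - p.

(** w is congruent to - p modulo q, hence prime to q. The point (u, v) has index q X - w Z = 1. *)
Lemma bezout_wq : exists u v, u * q - v * w = 1.
Proof.
have [u [v uv]] := Bezoutz p q; rewrite (eqP hcop) in uv.
by exists (v + u * (e - 1)), u; rewrite /w -uv; ring.
Qed.

Lemma sum_coloring_hom (Q : invQuandle)
    (x : seg (sum_diagram t1 t2 t3 t4) -> Q) :
  colors x ->
  exists F : R1_quandle -> Q,
    [/\ qhom F, forall l, F (base l) = x (arc t1 t2 t3 t4 l),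
        forall y, (exists u, x y = F u) &
        forall u v, lattice_eq w q u v -> F u = F v].
Proof.
move=> xc.
have [[x1 x2 x3 x4] [a1 a2] [b1 b2] [d1 d2] [k1 k2]] := (colors_sum x).1 xc.
have [_ n1 [e1 s1 z1] u1] := h1; have [f1 l1 f1E] := u1 _ _ x1.
have [_ n2 [e2 s2 z2] u2] := h2; have [f2 l2 f2E] := u2 _ _ x2.
have [_ n3 [e3 s3 z3] u3] := h3; have [f3 l3 f3E] := u3 _ _ x3.
have [_ n4 [e4 s4 z4] u4] := h4; have [f4 l4 f4E] := u4 _ _ x4.
rewrite !f1E !f2E ?e1 ?z1 ?n2 ?s2 in a1 a2.
rewrite !f2E !f3E e2 z2 n3 s3 in b1 b2.
rewrite !f3E !f4E e3 z3 n4 s4 in d1 d2.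
rewrite !f1E !f4E n1 s1 e4 z4 in k1 k2.
(* Both sides of R_1 are the color where the SE end of the first tangle meets the SW end of the
   second. *)
have [|F [hF Fb]] := @R1_universal Q (x \o arc t1 t2 t3 t4).
  rewrite /= !f1E f2E e1 s1 e2 (lineE l1 (k := 1 + 2)) //.
  by rewrite a2 a1 (lineE l2 (k := 2)).
have F1 : F (inl (0, 1)) = f1 2 by rewrite (Fb g1) /= f1E s1.
have F2 : F (inr 0) = f1 1 by rewrite (Fb g2) /= f1E e1.
have F3 : F (inl (0, 0)) = f3 0 by rewrite (Fb g3) /= f2E e2.
have F10 : F (inl (1, 0)) = f3 q.
  rewrite -b2 -(@lineE _ _ 1 2 (1 + 2) l2) // -(@lineE _ _ 0 1 2 l2) //.
  by rewrite -a1 b1 -F2 -F3 -!hF.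
have Fm11 : F (inl (- 1, 1)) = f1 0.
  by rewrite -(@lineE _ _ 2 1 0 l1) // -F1 -F2 -hF.
(* The row of twists is glued to the ends p and p + q of the third tangle. *)
have f43 n : f4 n = f3 (p + n * q).
  apply: (@line_eq _ f4 (fun n => f3 (p + n * q)) 0) => //.
  - exact: line_affine.
  - by rewrite mul0r addr0.
  - by rewrite add0r mul1r.
(* Rows and columns of points are lines, so agreement at two neighbors propagates: along the row Z =
   1, then the columns X = 0 and X = 1, then all rows. *)
have Fx1 n : F (inl (n, 1)) = f3 (- w + n * q).
  apply: etrans (line_eq (k := - 1) (line_inl 0 1 1 0 hF)
    (line_affine (- w) q l3) _ _ n).
  - by congr (F (inl (_, _))); ring.
  - by rewrite mulr1 mulr0 add0r addr0 Fm11 k1 f43; congr f3; rewrite /w; ring.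
  - by rewrite addNr !mul0r !addr0 F1 k2 f43; congr f3; rewrite /w; ring.
have F0z z : F (inl (0, z)) = f3 (0 + z * - w).
  apply: etrans (line_eq (k := 0) (line_inl 0 0 0 1 hF)
    (line_affine 0 (- w) l3) _ _ z).
  - by congr (F (inl (_, _))); ring.
  - by rewrite !mul0r !addr0 F3.
  - by rewrite !add0r !mul1r Fx1 mul0r addr0.
have F1z z : F (inl (1, z)) = f3 (q + z * - w).
  apply: etrans (line_eq (k := 0) (line_inl 1 0 0 1 hF)
    (line_affine q (- w) l3) _ _ z).
  - by congr (F (inl (_, _))); ring.
  - by rewrite !mul0r !addr0 F10.
  - by rewrite !add0r !mul1r addr0 Fx1 mul1r addrC.
have Fxz n z : F (inl (n, z)) = f3 (z * - w + n * q).
  apply: etrans (line_eq (k := 0) (line_inl 0 1 z 0 hF)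
    (line_affine (z * - w) q l3) _ _ n).
  - by congr (F (inl (_, _))); ring.
  - by rewrite !mul0r !addr0 F0z add0r.
  - by rewrite !add0r !mul1r addr0 F1z addrC.
(* (w, q) leaves the index q X - w Z unchanged; the invariance under (w, - q) and that of the class
   of 2 follow through the action. *)
have lat : forall u v, lattice_eq w q u v -> F u = F v.
  have P n z : F (inl (n, z)) = F (inl (n + w, z + q)).
    by rewrite !Fxz; congr f3; ring.
  apply: lattice_eq_invariant => [//|n z|k].
    have := congr1 (fun y => qop y (F (inr 0))) (P (- 1 - n - w) (z - q)).
    by rewrite -!hF /= => /esym; congr (F (inl (_, _)) = F (inl (_, _))); lia.
  have := congr1 (qop (F (inr (1 - k)))) (P 0 0).
  by rewrite -!hF /=; congr (F (inr _) = F (inr _)); lia.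
have f3im n : exists u, f3 n = F u.
  have [u [v uv]] := bezout_wq; exists (inl (n * u, n * v)).
  by rewrite Fxz; congr f3; rewrite -[LHS]mulr1 -uv; ring.
exists F; split=> //.
have [l1' _ f1im] : exists2 l : int -> R1_quandle,
    [/\ line l, l 0 = inl (- 1, 1) & l 1 = inr 0] & forall n, f1 n = F (l n).
  exact: line_image.
have [l2' _ f2im] : exists2 l : int -> R1_quandle,
    [/\ line l, l 0 = inr 0 & l 1 = inl (0, 0)] & forall n, f2 n = F (l n).
  by apply: line_image => //; [rewrite -a1|rewrite b1].
case=> [[[s|s]|s]|s].
- by have -> := f1E s; rewrite f1im; exists (l1' (c1 s)).
- by have -> := f2E s; rewrite f2im; exists (l2' (c2 s)).
- by have -> := f3E s; apply: f3im.
- by have -> := f4E s; rewrite f43; apply: f3im.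
Qed.

(** The first two tangles are colored by lines of [R1_quandle], the other two by the line n -> (n u,
    n v). The ends match modulo multiples of (w, q) because u q - v w = 1. *)
Lemma sum_coloring_exists (Q : invQuandle) (F : R1_quandle -> Q) :
  qhom F -> (forall u v, lattice_eq w q u v -> F u = F v) ->
  exists y : seg (sum_diagram t1 t2 t3 t4) -> Q,
    colors y /\ forall l, y (arc t1 t2 t3 t4 l) = F (base l).
Proof.
move=> hF Fl; have [u [v uv]] := bezout_wq.
have [m1 [ml1 m10 m11]] := @line_exists R1_quandle (inl (- 1, 1)) (inr 0).
have [m2 [ml2 m20 m21]] := @line_exists R1_quandle (inr 0) (inl (0, 0)).
have m12 : m1 2 = inl (0, 1).
  by rewrite -(@lineE _ _ 0 1 2 ml1) // m10 m11.
have m13 : m1 (1 + 2) = inr 1.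
  by rewrite -(@lineE _ _ 1 2 (1 + 2) ml1) // m12 m11.
have m22 : m2 2 = inr 1.
  by rewrite -(@lineE _ _ 0 1 2 ml2) // m20 m21.
have m23 : m2 (1 + 2) = inl (1, 0).
  by rewrite -(@lineE _ _ 1 2 (1 + 2) ml2) // m22 m21.
pose f3 n := F (inl (0 + n * u, 0 + n * v)).
have l3 : line f3 by apply: line_inl.
have l1 : line (F \o m1) by apply: line_qhom.
have l2 : line (F \o m2) by apply: line_qhom.
have l4 : line (fun n => f3 (p + n * q)) by apply: line_affine.
pose y (s : seg (sum_diagram t1 t2 t3 t4)) : Q :=
  match s with
  | inl (inl (inl s)) => F (m1 (c1 s))
  | inl (inl (inr s)) => F (m2 (c2 s))
  | inl (inr s) => f3 (c3 s)
  | inr s => f3 (p + c4 s * q)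
  end.
have y1 s : y (in1 t2 t3 t4 s) = F (m1 (c1 s)) by [].
have y2 s : y (in2 t1 t3 t4 s) = F (m2 (c2 s)) by [].
have y3 s : y (in3 t1 t2 t4 s) = f3 (c3 s) by [].
have y4 s : y (in4 t1 t2 t3 s) = f3 (p + c4 s * q) by [].
have [k1 n1 [e1 s1 z1] _] := h1; have [k2 n2 [e2 s2 z2] _] := h2.
have [k3 n3 [e3 s3 z3] _] := h3; have [k4 n4 [e4 s4 z4] _] := h4.
exists y; split.
  apply: (colors_sum y).2; split.
  - split.
    + exact: (colors_qhom l1 k1).
    + exact: (colors_qhom l2 k2).
    + exact: (colors_qhom l3 k3).
    + exact: (colors_qhom l4 k4).
  - by rewrite !y1 !y2 e1 z1 n2 s2 m11 m20 m13 m22.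
  - rewrite !y2 !y3 e2 z2 n3 s3 m21 m23; split.
      by congr (F (inl (_, _))); ring.
    apply: Fl; exists v, 0; split; rewrite /=; last ring.
    by rewrite -[X in _ = X + _]uv; ring.
  - rewrite !y3 !y4 e3 z3 n4 s4; split; congr f3; ring.
  (* The ends NE and SE of the row have indices p - e q = - w - q and - w. *)
  - rewrite !y1 !y4 n1 s1 e4 z4 m10 m12; split.
      apply: Fl; exists (- u - v), 0; split; rewrite /=.
        by rewrite -[in RHS]uv /w; ring.
      by rewrite -[in RHS]uv /w; ring.
    apply: Fl; exists (- u), 0; split; rewrite /=.
      by rewrite /w; ring.
    by rewrite -[in RHS]uv /w; ring.
case.
- by rewrite [LHS]y1 s1 m12.
- by rewrite [LHS]y1 e1 m11.
- by rewrite [LHS]y2 e2 m21.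
Qed.

(** By [sum_coloring_hom] the three arcs generate and satisfy the relators. Conversely, the quandle
    presented by the relators colors the diagram, so an equality between words in the arcs holds
    there and follows from the relators. *)
Lemma sum_presented (Q : invQuandle) (x : seg (sum_diagram t1 t2 t3 t4) -> Q) :
  is_Q2 x -> presented (rel123 p q e) (fun i => x (arc t1 t2 t3 t4 i)).
Proof.
move=> xP.
have xc : colors x by apply/colorsP => s t; apply: presented_rel.
have [F [hF Fb xF Fl]] := sum_coloring_hom xc.
set g := fun i => _.
have evF t : eval g t = F (eval base t).
  by rewrite (eval_qhom _ _ hF); congr eval; apply/funext => l; rewrite /= Fb.
split=> [z|s t].
  have [t <-] := xP.1 z.
  have [u ->] : exists u, eval x t = F u.
    elim: t => [a|s [u eu] t [v ev]] /=; first exact: xF.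
    by exists (qop u v); rewrite eu ev hF.
  elim/R1_ind: u => [l|l u [s es]]; first by exists (Gen l); rewrite /= Fb.
  by exists (Op s (Gen l)); rewrite /= es hF Fb.
split=> [st|]; last first.
  apply: qeq_eval => s' t' /(rel123_lattice hp hpq) /Fl.
  by rewrite !evF.
have [P [h hP]] := presented_exists (rel123 p q e).
have [G [hG Gb _ GE]] := presented_lattice hp hpq hcop hP.
have [y [yc yb]] := sum_coloring_exists hG (fun u v => (GE u v).2).
apply/hP.2.
have yh r : eval h r = eval y (map_term (arc t1 t2 t3 t4) r).
  by rewrite eval_map_term; congr eval; apply/funext => l; rewrite /= yb Gb.
rewrite !yh; apply: presented_lift xP _ _; first exact/colorsP.
by rewrite !eval_map_term.
Qed.

End SumDiagram.

(** * The Cayley components of the quandle of L *)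

Theorem theorem4p1 (p q e : int) (hp : 0 < p) (hpq : p < q)
    (hcop : coprimez p q)
    (D : diagram) (hD : montesinos_diagram p q e D)
    (Q : invQuandle) (x : seg D -> Q) (hQ : is_Q2 x) :
  (* 1, 2, 3 can be taken to be three arcs of the diagram *)
  (exists a : gen -> seg D, presented (rel123 p q e) (fun i => x (a i))) /\
  (forall g : gen -> Q, presented (rel123 p q e) g ->
    let w := (e - 1) * q - p in
    let C (i : gen) := component (cayley g) (g i) in
    (~~ evenz q ->
       [/\ C g1 = C g3,
           is_T_quotient (C g1) (g g1) [set rho 0 0; rho w 0; rho 0 (2 * q)] &
           is_T_quotient (C g2) (g g2) [set tau 0 4; phi 0; phi w]]) /\
    (evenz q ->
       [/\ is_T_quotient (C g1) (g g1)
             [set rho 0 0; rho 0 (2 * q); gamma (halfz q) (halfz (w - 1))],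
           is_T_quotient (C g2) (g g2) [set tau 0 4; phi 0; phi w],
           is_T_quotient (C g3) (g g3)
             [set rho 0 2; rho 0 (2 + 2 * q); gamma (halfz q) (halfz (w - 1))] &
           marked_iso (C g3) (g g3) (trade13 (C g1)) (g g1)])).
Proof.
split.
  case: hD => r1 [r2 [r3 [R1 R2 R3 eD]]]; subst D.
  have cop12 : coprimez 1 2 by [].
  have cope : coprimez (- e) 1 by rewrite /coprimez gcdz1.
  have twe : rational_diagram (twist_row e) (- e) 1.
    by rewrite /rational_diagram slope_twist_row.
  have [c1 h1] := rational_coloring R1 cop12.
  have [c2 h2] := rational_coloring R2 cop12.
  have [c3 h3] := rational_coloring R3 hcop.
  have [c4 h4] := rational_coloring twe cope.
  exists (arc (rtangle r1) (rtangle r2) (rtangle r3) (rtangle (twist_row e))).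
  exact: (sum_presented hp hpq hcop h1 h2 h3 h4).
move=> g gP w C.
have [F FP] := presented_lattice hp hpq hcop gP.
split=> pq.
  split; [|exact: (T_quotient_odd FP)|exact: (T_quotient_2 FP)].
  apply: component_connected.
  (* For odd q, R_2 expresses 3 as 1 acted on by a word. *)
  have [W ->] : exists W, g g3 = act g (g g1) W.
    case: (boolP (evenz p)) => pp.
      eexists; rewrite -eval_texp.
      exact: presented_rel gP (rel_R2_even_odd e pp pq).
    eexists; rewrite -eval_texp.
    exact: presented_rel gP (rel_R2_odd_odd e pp pq).
  exact: connected_act.
have pp : ~~ evenz p.
  apply/negP => pp; have : (2 %| gcdz p q)%Z by rewrite dvdz_gcd; apply/andP.
  by rewrite (eqP hcop).
have ow : ~~ evenz w by rewrite /w /evenz in pp pq *; lia.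
split.
- have n12 : g1 <> g2 by [].
  by have := T_quotient_even FP n12 ow pq; rewrite /center add0r.
- exact: (T_quotient_2 FP).
- have n32 : g3 <> g2 by [].
  exact: (T_quotient_even FP n32 ow pq).
- by have [s [hs sK sg]] := swap_exists FP; apply: (trade13_iso g3 hs sK sg).
Qed.
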